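(* Let $E$ be a complete $\mathbb{C}$-normable space. Let $\sigma$ be a continuous anti-linear involution of $E$, and let $E_{\mathbb{R}}$ be the real subspace of $E$ fixed by $\sigma$, so that $E=E_{\mathbb{R}}\oplus iE_{\mathbb{R}}$. Denote by $\pi_{\mathbb{R}}:E\to E_{\mathbb{R}}$ the projection along $iE_{\mathbb{R}}$ onto $E_{\mathbb{R}}$. Let $f_{\mathbb{R}}:E_{\mathbb{R}}\to\mathbb{R}$ be a continuous function, and let $f=f_{\mathbb{R}}\circ\pi_{\mathbb{R}}$. Then $f_{\mathbb{R}}$ is convex if and only if $f$ is plurisubharmonic, and $f_{\mathbb{R}}$ is strictly convex if and only if $f$ is strictly plurisubharmonic.
   Context: A normable space is a topological vector space whose topology can be defined by a norm. A continuous function $g:X\to\mathbb{R}$ on a convex subset $X$ of a topological real affine space $F$ is convex if for all (real) affine maps $\gamma:[-1,1]\to F$ with values in $X$, $g(\gamma(0))\leq\frac{g(\gamma(-1))+g(\gamma(1))}{2}$; it is strictly convex if moreover this inequality is strict whenever $\gamma$ is non-constant. Let $\bar{\mathbb{D}}\subset\mathbb{C}$ be the closed unit disc. A map defined on $\bar{\mathbb{D}}$ is holomorphic if it extends to a holomorphic map on a neighbourhood of $\bar{\mathbb{D}}$. An upper semicontinuous function $f:X\to\mathbb{R}\cup\{-\infty\}$ on a holomorphic manifold $X$ (for instance $X=E$) is plurisubharmonic if for all holomorphic maps $\gamma:\bar{\mathbb{D}}\to X$, $f(\gamma(0))\leq\frac{1}{2\pi}\int_0^{2\pi}f(\gamma(e^{it}))\,dt$;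 it is strictly plurisubharmonic if moreover this inequality is strict whenever $\gamma$ is non-constant. *)

(* Defs.v *)
From HB Require Import structures.
From mathcomp Require Import all_boot all_order all_algebra.
From mathcomp Require Import complex.
From mathcomp Require Import all_classical all_reals all_analysis.

Set Implicit Arguments.
Unset Strict Implicit.
Unset Printing Implicit Defensive.

Import Order.TTheory GRing.Theory Num.Theory.
Import numFieldNormedType.Exports.

Local Open Scope classical_set_scope.
Local Open Scope complex_scope.
Local Open Scope ring_scope.

(* The vector spaces below are complex; they are regarded as real vector
   spaces by letting r : R act as the scalar r%:C : R[i]. *)

Section Convexity.
Variables (R : realType) (F : normedModType R[i]).

Definition real_affine_on (A : set R) (gam : R -> F) : Prop :=
  forall s t l : R, A s -> A t -> l \in `[0, 1] ->
    gam ((1 - l) * s + l * t) = (1 - l)%:C *: gam s + l%:C *: gam t.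

(* Real affine maps [-1, 1] -> F with values in X. *)
Definition segment_in (X : set F) (gam : R -> F) : Prop :=
  real_affine_on `[-1, 1] gam /\ (forall s, s \in `[-1, 1] -> X (gam s)).

(* A function on a subset X of F is represented by a function on F of which
   only the values on X matter, with continuity for the subspace topology.
   X is meant to be convex. *)
Definition convex_fun (X : set F) (g : F -> R) : Prop :=
  {within X, continuous g} /\
  forall gam, segment_in X gam ->
    g (gam 0) <= (g (gam (-1)) + g (gam 1)) / 2.

Definition strictly_convex_fun (X : set F) (g : F -> R) : Prop :=
  convex_fun X g /\
  forall gam, segment_in X gam ->
    (exists s t, [/\ s \in `[-1, 1], t \in `[-1, 1] & gam s != gam t]) ->
    g (gam 0) < (g (gam (-1)) + g (gam 1)) / 2.

End Convexity.

Section Plurisubharmonicity.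
Variables (R : realType) (E : completeNormedModType R[i]).

Definition closed_unit_disc : set R[i] := [set z | `|z| <= 1].

(* The field of scalars is R[i], so that derivable is complex
   differentiability. *)
Definition holomorphic_on (U : set R[i]) (gam : R[i] -> E) : Prop :=
  forall z, U z -> derivable (gam : R[i]^o -> E) z 1.

(* Only the values of gam on the closed disc matter. *)
Definition holomorphic_disc (gam : R[i] -> E) : Prop :=
  exists (U : set R[i]^o) (del : R[i] -> E),
    [/\ open U, closed_unit_disc `<=` U, holomorphic_on U del &
        forall z, closed_unit_disc z -> gam z = del z].

Definition nonconstant_disc (gam : R[i] -> E) : Prop :=
  exists z w, [/\ closed_unit_disc z, closed_unit_disc w & gam z != gam w].

Definition expi (t : R) : R[i] := cos t +i* sin t.

Definition circle_mean (f : E -> \bar R) (gam : R[i] -> E) : \bar R :=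
  (((2 * pi)^-1)%:E *
   \int[lebesgue_measure]_(t in `[0%R, (2 * pi)%R]) f (gam (expi t)))%E.

Definition upper_semicontinuous (f : E -> \bar R) : Prop :=
  lower_semicontinuous (fun x => - f x)%E.

Definition plurisubharmonic (f : E -> \bar R) : Prop :=
  [/\ forall x, f x != +oo%E,
      upper_semicontinuous f &
      forall gam, holomorphic_disc gam -> (f (gam 0%R) <= circle_mean f gam)%E].

Definition strictly_plurisubharmonic (f : E -> \bar R) : Prop :=
  plurisubharmonic f /\
  forall gam, holomorphic_disc gam -> nonconstant_disc gam ->
    (f (gam 0%R) < circle_mean f gam)%E.

End Plurisubharmonicity.

Section RealStructure.
Variables (R : realType) (E : completeNormedModType R[i]).

Definition antilinear (sigma : E -> E) : Prop :=
  {morph sigma : x y / x + y} /\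
  forall (a : R[i]) x, sigma (a *: x) = a^*%C *: sigma x.

Definition fixed_space (sigma : E -> E) : set E := [set x | sigma x = x].

Definition times_i (A : set E) : set E := [set 'i *: x | x in A].

(* When E is the direct sum of A and B, this determines p uniquely. *)
Definition projection_along (A B : set E) (p : E -> E) : Prop :=
  forall x, A (p x) /\ B (x - p x).

Lemma fixed_space_direct_sum (sigma : E -> E) :
    antilinear sigma -> involutive sigma ->
  (exists p, projection_along (fixed_space sigma)
               (times_i (fixed_space sigma)) p) /\
  fixed_space sigma `&` times_i (fixed_space sigma) = [set 0].
Proof.
move=> [sD sZ] sK.
have i2 : 'i%C * 'i%C = -1 :> R[i] by rewrite -expr2 sqr_i.
have ci : ('i%C : R[i])^*%C = - 'i%C.
  by apply/eqP; rewrite eq_complex /= oppr0 !eqxx.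
have s0 : sigma 0 = 0.
  by apply: (addrI (sigma 0)); rewrite -sD !addr0.
have sN x : sigma (- x) = - sigma x.
  by apply/eqP; rewrite -addr_eq0 -sD addNr s0.
have c2 : (2^-1 : R[i])^*%C = 2^-1 by rewrite conjc_inv conjc_nat.
have ci2 : (- ('i%C / 2) : R[i])^*%C = 'i%C / 2.
  have cM (a b : R[i]) : (a * b)^*%C = a^*%C * b^*%C by exact: rmorphM.
  by rewrite -mulNr cM c2 -ci conjcK.
split.
  exists (fun x => 2^-1 *: (x + sigma x)) => x; split.
    by rewrite /fixed_space /= sZ sD sK c2 addrC.
  exists (- ('i%C * 2^-1) *: (x - sigma x)).
    rewrite /fixed_space /= sZ sD sN sK ci2.
    by rewrite scaleNr -scalerN opprB.
  rewrite scalerA mulrN mulrA i2 mulN1r opprK scalerBr scalerDr opprD addrA.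
  congr (_ - _); apply/eqP; rewrite eq_sym subr_eq -scalerDl.
  by rewrite -[2^-1]div1r -splitr scale1r.
apply/seteqP; split=> [x [/= sx [y /= sy xy]]|x /= ->]; last first.
  by split; [exact: s0|exists 0; [exact: s0|rewrite scaler0]].
move: sx; rewrite -xy /fixed_space /= sZ sy ci scaleNr => /eqP.
rewrite eq_sym -addr_eq0 -mulr2n -scaler_nat scaler_eq0 pnatr_eq0 /=.
by move/eqP.
Qed.

End RealStructure.

(* Main.v *)
(** The core is a vector-valued mean value property: if [gam] is
    complex differentiable at every point of the closed disc, the averages of
    [gam] over the [2 ^ m]-th roots of unity tend to [gam 0]. This is Goursat's
    theorem for [w |-> gam (exp (2 pi w))], proved on Riemann sums by bisection,
    so that no vector-valued integral is needed: by periodicity the means over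
    the circles of radii [exp (- 2 pi q)] agree in the limit. Jensen's
    inequality for [2 ^ m] points and continuity then give
    convex => plurisubharmonic.
    Conversely, the mean inequality on the discs [a + (c + r z) v] says that
    [h s = fR (a + s v)] satisfies [h c <= mean of h (c + r cos t)], and such an
    [h] lies below its chords.

    For strictness, put [u = piR o gam]. If [u] is not constant on the circle,
    strict convexity gains when [gam] is averaged with one of its rotations,
    which changes neither [gam 0] nor the mean of [fR o u]. If [u] is constant
    there, moving the centre by Moebius maps shows that it is constant on the
    disc, hence [gam' = 0]. *)
Require Import Defs.
From HB Require Import structures.
From mathcomp Require Import all_boot all_order all_algebra.
From mathcomp Require Import complex.
From mathcomp Require Import all_classical all_reals all_analysis.
From mathcomp Require Import ring lra.

Set Implicit Arguments.
Unset Strict Implicit.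
Unset Printing Implicit Defensive.

Import Order.TTheory GRing.Theory Num.Theory.
Import numFieldNormedType.Exports.

Local Open Scope classical_set_scope.
Local Open Scope complex_scope.
Local Open Scope ring_scope.

Local Notation Re := complex.Re.
Local Notation Im := complex.Im.

(** * Real-valued norms, and epsilon-delta forms of limits and complex derivatives *)

Section RealNorm.
Variables (R : realType) (V : normedModType R[i]).
Implicit Types (x y : V) (a : R[i]) (r : R).

(* The norm of V is a nonnegative real element of R[i]; rnorm is its value
   in R, where the order is total. *)
Definition rnorm (x : V) : R := Re `|x|.

Lemma normE x : `|x| = (rnorm x)%:C.
Proof. by rewrite RRe_real// normr_real. Qed.

Lemma rnorm_ge0 x : 0 <= rnorm x.
Proof. by rewrite -lecR -normE normr_ge0. Qed.

Lemma rnorm0 : rnorm 0 = 0.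
Proof. by rewrite /rnorm normr0. Qed.

Lemma rnorm_eq0 x : (rnorm x == 0) = (x == 0).
Proof. by rewrite -[RHS]normr_eq0 normE -(inj_eq (@complexI R)). Qed.

Lemma rnormN x : rnorm (- x) = rnorm x.
Proof. by rewrite /rnorm normrN. Qed.

Lemma rdistC x y : rnorm (x - y) = rnorm (y - x).
Proof. by rewrite -rnormN opprB. Qed.

Lemma ler_rnormD x y : rnorm (x + y) <= rnorm x + rnorm y.
Proof. by rewrite -lecR rmorphD /= -!normE ler_normD. Qed.

Lemma ler_rnormB x y : rnorm (x - y) <= rnorm x + rnorm y.
Proof. by rewrite (le_trans (ler_rnormD _ _))// rnormN. Qed.

Lemma ler_rdistD y x z : rnorm (x - z) <= rnorm (x - y) + rnorm (y - z).
Proof. by rewrite (le_trans _ (ler_rnormD _ _))// addrA subrK. Qed.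

Lemma ler_dist_rnorm x y : `|rnorm x - rnorm y| <= rnorm (x - y).
Proof.
have h u v : rnorm u - rnorm v <= rnorm (u - v).
  by rewrite lerBlDr (le_trans _ (ler_rnormD _ _))// subrK.
by rewrite ler_norml h andbT lerNl opprB rdistC h.
Qed.

Lemma rnormZ a x : rnorm (a *: x) = Re `|a| * rnorm x.
Proof.
apply: (@complexI R).
by rewrite rmorphM /= -!normE normrZ.
Qed.

Lemma rnormZr r x : rnorm (r%:C *: x) = `|r| * rnorm x.
Proof. by rewrite rnormZ normc_def /= expr0n addr0 sqrtr_sqr. Qed.

Lemma rnorm_sum I (s : seq I) (P : pred I) (F : I -> V) :
  rnorm (\sum_(i <- s | P i) F i) <= \sum_(i <- s | P i) rnorm (F i).
Proof.
elim/big_ind2 : _ => [|x1 x2 y1 y2 h1 h2|//]; first by rewrite rnorm0.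
by rewrite (le_trans (ler_rnormD _ _))// lerD.
Qed.

Lemma nbhs_rnormP x (P : set V) :
  nbhs x P <-> exists2 e : R, 0 < e & forall y, rnorm (y - x) < e -> P y.
Proof.
split=> [/nbhs_normP[e /= e0 eP]|[e e0 eP]].
  have er : e = (Re e)%:C by rewrite RRe_real// gtr0_real.
  exists (Re e); first by rewrite -ltcR -er.
  move=> y yx; apply: eP => /=.
  by rewrite distrC normE er ltcR.
apply/nbhs_normP; exists e%:C => /=; first by rewrite /= ltcR.
by move=> y /= yx; apply: eP; rewrite -ltcR -normE distrC.
Qed.

Lemma cvg_rnormP {T} {F : set_system T} {FF : Filter F} (u : T -> V) x :
  u t @[t --> F] --> x <->
  forall e : R, 0 < e -> \forall t \near F, rnorm (u t - x) <= e.
Proof.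
split=> [ux e e0|h].
  have /cvgrPdist_le/(_ e%:C) := ux.
  rewrite ltcR => /(_ e0); apply: filterS => t.
  by rewrite distrC normE lecR.
apply/cvgrPdist_le => e e0.
have er : e = (Re e)%:C by rewrite RRe_real// gtr0_real.
rewrite er ltcR in e0; have := h _ e0.
by apply: filterS => t; rewrite distrC normE er lecR.
Qed.

End RealNorm.

Lemma rnorm_complex (R : realType) (z : R[i]) :
  rnorm (z : R[i]^o) = Num.sqrt (Re z ^+ 2 + Im z ^+ 2).
Proof. by rewrite /rnorm normc_def. Qed.

Lemma rnormcM (R : realType) (z w : R[i]) :
  rnorm (z * w : R[i]^o) = rnorm (z : R[i]^o) * rnorm (w : R[i]^o).
Proof. exact: rnormZ. Qed.

Lemma ler_rnormReIm (R : realType) (z : R[i]) :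
  rnorm (z : R[i]^o) <= `|Re z| + `|Im z|.
Proof.
rewrite rnorm_complex -ler_sqr ?nnegrE ?addr_ge0 ?sqrtr_ge0//.
rewrite sqr_sqrtr ?addr_ge0 ?sqr_ge0// sqrrD !real_normK ?num_real//.
by rewrite addrAC lerDl mulrn_wge0 ?mulr_ge0.
Qed.

Lemma normRe_le (R : realType) (z : R[i]) : `|Re z| <= rnorm (z : R[i]^o).
Proof. by rewrite rnorm_complex -sqrtr_sqr ler_wsqrtr// lerDl sqr_ge0. Qed.

Lemma normIm_le (R : realType) (z : R[i]) : `|Im z| <= rnorm (z : R[i]^o).
Proof. by rewrite rnorm_complex -sqrtr_sqr ler_wsqrtr// lerDr sqr_ge0. Qed.

(** The limit of difference quotients is multiplied out by [w - p], so that no division remains and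
    [w = p] is no exception. *)
Lemma derivable_rnormP (R : realType) (V : normedModType R[i]) (F : R[i] -> V)
    (p : R[i]) : derivable (F : R[i]^o -> V) p 1 ->
  exists A : V, forall e : R, 0 < e -> exists2 d : R, 0 < d & forall w : R[i],
    rnorm (w - p : R[i]^o) < d ->
    rnorm (F w - F p - (w - p) *: A) <= e * rnorm (w - p : R[i]^o).
Proof.
move=> dF; exists ('D_1 (F : R[i]^o -> V) p) => e e0.
have /cvg_rnormP/(_ e e0) := dF.
rewrite -nbhs_nearE => /nbhs_rnormP[d d0 dP].
exists d => // w wp.
have [->|wpn] := eqVneq w p.
  by rewrite !subrr scale0r subrr !rnorm0 mulr0.
have wp0 : w - p != 0 by rewrite subr_eq0.
have := dP (w - p); rewrite subr0 => /(_ wp wp0).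
rewrite /= /shift /= [_ *: 1]mulr1 subrK => h.
have -> : F w - F p - (w - p) *: 'D_1 (F : R[i]^o -> V) p =
    (w - p) *: ((w - p)^-1 *: (F w - F p) - 'D_1 (F : R[i]^o -> V) p).
  by rewrite scalerBr scalerA divff// scale1r.
by rewrite rnormZ mulrC ler_wpM2r// (rnorm_ge0 (w - p : R[i]^o)).
Qed.

Lemma rnorm_derivable (R : realType) (V : normedModType R[i]) (F : R[i] -> V)
    (p : R[i]) (A : V) : (forall e : R, 0 < e -> exists2 d : R, 0 < d &
    forall w : R[i], rnorm (w - p : R[i]^o) < d ->
    rnorm (F w - F p - (w - p) *: A) <= e * rnorm (w - p : R[i]^o)) ->
  is_derive (p : R[i]^o) (1 : R[i]^o) (F : R[i]^o -> V) A.
Proof.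
move=> h.
suff hc : h^-1 *: ((F \o shift p) (h *: (1 : R[i]^o)) - F p)
    @[h --> (0 : R[i]^o)^'] --> A.
  by split; [apply/cvg_ex; exists A|exact: cvg_lim hc].
apply/cvg_rnormP => e e0; rewrite -nbhs_nearE; apply/nbhs_rnormP.
have [d d0 dP] := h e e0; exists d => // w; rewrite subr0 => wd w0.
rewrite /= /shift /= [_ *: 1]mulr1.
have := dP (w + p); rewrite addrK => /(_ wd) hw.
have -> : w^-1 *: (F (w + p) - F p) - A =
    w^-1 *: (F (w + p) - F p - w *: A).
  by rewrite [RHS]scalerBr scalerA mulVf// scale1r.
rewrite rnormZ.
have wn0 : 0 < rnorm (w : R[i]^o).
  by rewrite lt_def rnorm_eq0 w0 rnorm_ge0.
have -> : Re `|w^-1| = (rnorm (w : R[i]^o))^-1.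
  apply: (mulfI (lt0r_neq0 wn0)); rewrite divff ?gt_eqF//.
  rewrite -[Re _]/(rnorm (w^-1 : R[i]^o)) -rnormcM divff//.
  by rewrite /rnorm normr1.
by rewrite mulrC ler_pdivrMr.
Qed.

(** * Goursat's theorem for Riemann sums *)

(** The supremum of the left endpoints works, since each of them lies below every right endpoint. *)
Lemma nested_intervals (R : realType) (a b : nat -> R) :
  (forall k, a k <= a k.+1) ->
  (forall k, b k.+1 <= b k) -> (forall k, a k <= b k) ->
  exists c, forall k, a k <= c <= b k.
Proof.
move=> aS bS ab.
have aP k l : a k <= a (k + l)%N.
  by elim: l => [|l ih]; rewrite ?addn0// addnS (le_trans ih).
have bP k l : b (k + l)%N <= b k.
  by elim: l => [|l ih]; rewrite ?addn0// addnS (le_trans _ ih).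
have abP k l : a k <= b l.
  rewrite (le_trans (aP k l))// (le_trans (ab _))// addnC; exact: bP.
exists (sup (range a)) => k; apply/andP; split.
  apply: ub_le_sup; last by exists k.
  by exists (b 0) => _ [l _ <-].
apply: sup_le_ub; first by exists (a 0), 0.
by move=> _ [l _ <-].
Qed.

Lemma halving_lt (R : realType) (h d : R) : 0 < d -> exists k, h / 2 ^+ k < d.
Proof.
move=> d0; have /cvgrPdist_lt/(_ d d0) : h / 2 ^+ k @[k --> \oo] --> (0 : R).
  rewrite -[X in _ --> X](mulr0 h); apply: cvgMr.
  under eq_fun do rewrite -exprVn.
  apply: cvg_expr; rewrite ger0_norm//; lra.
case=> k _ /(_ k (leqnn _)) /=; rewrite sub0r normrN => hd.
by exists k; rewrite (le_lt_trans (ler_norm _)).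
Qed.

(** If [P] failed, it would fail on one of the four quarters, and so on; these squares shrink to a
    point [(s, t)], where the local hypothesis contradicts the failure. An abstract [P] serves both
    Goursat's theorem and the convergence of real Riemann sums. *)
Lemma dyadic_cousin (R : realType) (P : R -> R -> R -> Prop) (h x y : R) :
  0 < h ->
  (forall h x y, let k := h / 2 in P k x y -> P k (x + k) y ->
    P k x (y + k) -> P k (x + k) (y + k) -> P h x y) ->
  (forall s t, x <= s <= x + h -> y <= t <= y + h ->
    exists2 d, 0 < d & forall h x y, 0 < h -> h < d ->
      x <= s <= x + h -> y <= t <= y + h -> P h x y) ->
  P h x y.
Proof.
move=> h0 Psplit Plocal; apply: contrapT => nP.
(* A triple holds the side and the lower left corner. The conclusion is conditional on failure and
   positive side, so a choice function exists on all triples, with an arbitrary default for the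
   others. *)
pose next (u v : R * (R * R)) := ~ P u.1 u.2.1 u.2.2 -> 0 < u.1 ->
  [/\ ~ P v.1 v.2.1 v.2.2, v.1 = u.1 / 2,
      u.2.1 <= v.2.1 /\ v.2.1 + v.1 <= u.2.1 + u.1 &
      u.2.2 <= v.2.2 /\ v.2.2 + v.1 <= u.2.2 + u.1].
have [nx nxP] : {nx & forall u, next u (nx u)}.
  apply: choice => -[k [s t]].
  case: (pselect (~ P k s t /\ 0 < k)) => [[ns k0]|ns]; last first.
    by exists (0, (0, 0)) => ? ?; exfalso; apply: ns.
  suff [v [vs vk vs1 vs2]] : exists v, [/\ ~ P (k / 2) v.1 v.2, 0 < k,
      v.1 = s \/ v.1 = s + k / 2 & v.2 = t \/ v.2 = t + k / 2].
    exists (k / 2, v) => _ _ /=; split => //; split.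
    - by case: vs1 => ->; lra.
    - by case: vs1 => ->; lra.
    - by case: vs2 => ->; lra.
    - by case: vs2 => ->; lra.
  apply: contrapT => nv; apply: ns.
  apply: Psplit; apply: contrapT => nc; apply: nv.
  - by exists (s, t); split => //; left.
  - by exists (s + k / 2, t); split => //; [right|left].
  - by exists (s, t + k / 2); split => //; [left|right].
  - by exists (s + k / 2, t + k / 2); split => //; right.
pose u k := iter k nx (h, (x, y)).
have uP k : ~ P (u k).1 (u k).2.1 (u k).2.2 /\ (u k).1 = h / 2 ^+ k.
  elim: k => [|k [nk hk]]; first by rewrite divr1.
  have uk0 : 0 < (u k).1 by rewrite hk divr_gt0// exprn_gt0.
  have [] := nxP _ nk uk0; rewrite -[nx (u k)]/(u k.+1) => nk1 hk1 _ _; split => //.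
  by rewrite hk1 hk exprSr invfM mulrA.
have uk0 k : 0 < (u k).1 by rewrite (uP k).2 divr_gt0// exprn_gt0.
have uS k := nxP _ (uP k).1 (uk0 k).
have [s sP] : exists s, forall k, (u k).2.1 <= s <= (u k).2.1 + (u k).1.
  by apply: nested_intervals => k; [| |by rewrite lerDl ltW];
    have [_ _ []] := uS k.
have [t tP] : exists t, forall k, (u k).2.2 <= t <= (u k).2.2 + (u k).1.
  by apply: nested_intervals => k; [| |by rewrite lerDl ltW];
    have [_ _ _ []] := uS k.
have [d d0 dP] := Plocal _ _ (sP 0) (tP 0).
have [k hk] := halving_lt h d0; rewrite -(uP k).2 in hk.
by apply: (uP k).1; apply: dP.
Qed.

Section Goursat.
Variables (R : realType) (V : normedModType R[i]).
Implicit Types (F G : R[i] -> V) (a h x y e : R) (m : nat).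

Let hedge F m a x y : V := \sum_(l < 2 ^ m) F ((x + l%:R * a) +i* y).
Let vedge F m a x y : V := \sum_(l < 2 ^ m) F (x +i* (y + l%:R * a)).

(* Left-endpoint Riemann sum, with step a, of F dw along the boundary of the
   square of side 2^m a whose lower left corner is x +i* y. *)
Definition square_sum F m a x y : V := let h := 2 ^+ m * a in
  a%:C *: (hedge F m a x y - hedge F m a x (y + h) +
           'i *: (vedge F m a (x + h) y - vedge F m a x y)).

Let hedgeS F m a x y : hedge F m.+1 a x y =
  hedge F m a x y + hedge F m a (x + 2 ^+ m * a) y.
Proof.
rewrite /hedge expnS mul2n -addnn big_split_ord /=; congr (_ + _).
by apply: eq_bigr => l _; rewrite natrD natrX mulrDl addrA.
Qed.

Let vedgeS F m a x y : vedge F m.+1 a x y =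
  vedge F m a x y + vedge F m a x (y + 2 ^+ m * a).
Proof.
rewrite /vedge expnS mul2n -addnn big_split_ord /=; congr (_ + _).
by apply: eq_bigr => l _; rewrite natrD natrX mulrDl addrA.
Qed.

(** The inner edges of the subdivision are traversed in opposite directions and cancel. The step [a]
    is the same on both sides, so this is exact for Riemann sums. *)
Lemma square_sumS F m a x y : let h := 2 ^+ m * a in
  square_sum F m.+1 a x y =
  square_sum F m a x y + square_sum F m a (x + h) y +
  (square_sum F m a x (y + h) + square_sum F m a (x + h) (y + h)).
Proof.
move=> h; rewrite /square_sum -/h -!scalerDr; congr (_ *: _).
have -> : 2 ^+ m.+1 * a = h + h by rewrite exprS -mulrA mulr_natl mulr2n.
rewrite !hedgeS !vedgeS -/h (addrA x) (addrA y).
(* [A'] and [B'] stand for the inner edges, which enter with both signs. *)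
have tele (A A' B B' C D : V) :
    A + B - (C + D) = (A - A') + (B - B') + ((A' - C) + (B' - D)).
  by rewrite [RHS]addrACA !addrA !subrK -addrA addrACA opprD addrA.
rewrite (tele _ (hedge F m a x (y + h)) _ (hedge F m a (x + h) (y + h))).
rewrite (tele _ (vedge F m a (x + h) y) _ (vedge F m a (x + h) (y + h))).
set a1 := hedge F m a x y - _; set a2 := hedge F m a (x + h) y - _.
set a3 := hedge F m a x (y + h) - _; set a4 := hedge F m a (x + h) (y + h) - _.
set b1 := _ - vedge F m a (x + h) y; set b2 := _ - vedge F m a (x + h) (y + h).
set b3 := vedge F m a (x + h) y - _; set b4 := vedge F m a (x + h) (y + h) - _.
rewrite [in RHS](addrACA a1) [in RHS](addrACA a3).
rewrite [RHS]addrACA -!scalerDr [b3 + b1]addrC [b4 + b2]addrC.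
by rewrite [b1 + b2 + _]addrACA.
Qed.

(** Samples on opposite sides differ by a fixed translation. The affine term therefore gives
    [- 'i * h] times [A] for each horizontal pair and, after the factor ['i], the opposite for each
    vertical pair. *)
Lemma square_sum_affine F G (c A : V) (p : R[i]) m a x y :
  (forall w, F w = G w + (c + (w - p) *: A)) ->
  square_sum F m a x y = square_sum G m a x y.
Proof.
move=> FG; rewrite /square_sum; congr (_ *: _); set h := 2 ^+ m * a.
have diff z u : F (z + u) - F z = G (z + u) - G z + u *: A.
  rewrite !FG opprD addrACA; congr (_ + _).
  rewrite opprD addrACA subrr add0r -scalerBl opprB addrA subrK.
  by rewrite addrAC subrr add0r.
have diffN z u : F z - F (z + u) = G z - G (z + u) - u *: A.
  by rewrite -opprB diff opprD opprB.
have -> : hedge F m a x y - hedge F m a x (y + h) =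
    hedge G m a x y - hedge G m a x (y + h) +
    \sum_(l < 2 ^ m) - (('i * h%:C) *: A).
  rewrite /hedge -!sumrB -big_split; apply: eq_bigr => l _ /=.
  have -> : (x + l%:R * a) +i* (y + h) =
      ((x + l%:R * a) +i* y) + 'i * h%:C :> R[i].
    by apply/eqP; rewrite eq_complex /=; apply/andP; split; apply/eqP; ring.
  exact: diffN.
have -> : vedge F m a (x + h) y - vedge F m a x y =
    vedge G m a (x + h) y - vedge G m a x y + \sum_(l < 2 ^ m) h%:C *: A.
  rewrite /vedge -!sumrB -big_split; apply: eq_bigr => l _ /=.
  have -> : (x + h) +i* (y + l%:R * a) =
      (x +i* (y + l%:R * a)) + h%:C :> R[i].
    by apply/eqP; rewrite eq_complex /=; apply/andP; split; apply/eqP; ring.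
  exact: diff.
rewrite scalerDr addrACA scaler_sumr -big_split /= big1 ?addr0// => l _.
by rewrite scalerA addNr.
Qed.

(** Length times supremum: each of the four sides carries [2 ^+ m] samples of weight [a]. *)
Lemma rnorm_square_sum F m a x y e : 0 <= a ->
  (forall s t, x <= s <= x + 2 ^+ m * a -> y <= t <= y + 2 ^+ m * a ->
    rnorm (F (s +i* t)) <= e) ->
  rnorm (square_sum F m a x y) <= 4 * (2 ^+ m * a) * e.
Proof.
move=> a0 Fe; rewrite /square_sum rnormZr ger0_norm//; set h := 2 ^+ m * a.
have h0 : 0 <= h by rewrite mulr_ge0// exprn_ge0.
have la (l : 'I_(2 ^ m)) z : z <= z + l%:R * a <= z + h.
  rewrite lerDl mulr_ge0//= lerD2l ler_wpM2r// -natrX ler_nat.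
  by rewrite ltnW.
have le_h z : z <= z <= z + h by rewrite lexx lerDl.
have le_h' z : z <= z + h <= z + h by rewrite lexx lerDl h0.
have hP y' : y <= y' <= y + h -> rnorm (hedge F m a x y') <= 2 ^+ m * e.
  move=> yy'; rewrite (le_trans (rnorm_sum _ _ _))//.
  rewrite (le_trans (ler_sum _ (G := fun=> e) _))//.
    by move=> l _; apply: Fe.
  by rewrite sumr_const card_ord -[e *+ _]mulr_natl natrX.
have vP x' : x <= x' <= x + h -> rnorm (vedge F m a x' y) <= 2 ^+ m * e.
  move=> xx'; rewrite (le_trans (rnorm_sum _ _ _))//.
  rewrite (le_trans (ler_sum _ (G := fun=> e) _))//.
    by move=> l _; apply: Fe.
  by rewrite sumr_const card_ord -[e *+ _]mulr_natl natrX.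
have -> : 4 * h * e = a * ((2 ^+ m * e + 2 ^+ m * e) +
    (2 ^+ m * e + 2 ^+ m * e)) by rewrite /h; ring.
rewrite ler_wpM2l// (le_trans (ler_rnormD _ _))// lerD//.
  by rewrite (le_trans (ler_rnormB _ _))// lerD// hP.
have -> : rnorm ('i *: (vedge F m a (x + h) y - vedge F m a x y)) =
    rnorm (vedge F m a (x + h) y - vedge F m a x y).
  by rewrite rnormZ normc_def /= expr0n expr1n add0r sqrtr1 mul1r.
by rewrite (le_trans (ler_rnormB _ _))// lerD// vP.
Qed.

(** The bound is proportional to the area, so the bounds for four quarters add up to the bound for
    the square. *)
Let small F e h x y := exists m0, forall m, (m0 <= m)%N ->
  rnorm (square_sum F m (h / 2 ^+ m) x y) <= e * h ^+ 2.

Let small_split F e h x y : let k := h / 2 in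
  small F e k x y -> small F e k (x + k) y ->
  small F e k x (y + k) -> small F e k (x + k) (y + k) -> small F e h x y.
Proof.
move=> k [m1 h1] [m2 h2] [m3 h3] [m4 h4].
exists (maxn (maxn m1 m2) (maxn m3 m4)).+1 => -[//|m].
rewrite ltnS !geq_max => /andP[/andP[hm1 hm2] /andP[hm3 hm4]].
have hk : h / 2 ^+ m.+1 = k / 2 ^+ m by rewrite exprS invfM mulrA.
have kE : 2 ^+ m * (k / 2 ^+ m) = k by rewrite mulrCA divff ?mulr1// expf_neq0.
rewrite hk square_sumS kE.
have -> : e * h ^+ 2 = (e * k ^+ 2 + e * k ^+ 2) + (e * k ^+ 2 + e * k ^+ 2).
  by rewrite /k; field.
rewrite (le_trans (ler_rnormD _ _))// lerD//;
  rewrite (le_trans (ler_rnormD _ _))// lerD//.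
- exact: h1.
- exact: h2.
- exact: h3.
- exact: h4.
Qed.

(** Removing the affine approximation at [p = s +i* t] does not change the sum. The remainder is at
    most [e / 8] times the distance to [p], which is at most [2 * h]; with perimeter [4 * h] this
    gives [e * h ^+ 2]. *)
Let small_local F e s t : 0 < e -> derivable (F : R[i]^o -> V) (s +i* t) 1 ->
  exists2 d, 0 < d & forall h x y, 0 < h -> h < d ->
    x <= s <= x + h -> y <= t <= y + h -> small F e h x y.
Proof.
move=> e0 /derivable_rnormP[A dA].
have e80 : 0 < e / 8 by rewrite divr_gt0.
have [d d0 dP] := dA _ e80.
exists (d / 2); first by rewrite divr_gt0.
move=> h x y h0 hd sx ty; exists 0 => m _.
have hE : 2 ^+ m * (h / 2 ^+ m) = h by rewrite mulrCA divff ?mulr1// expf_neq0.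
set p := s +i* t in dP.
rewrite (@square_sum_affine F (fun w => F w - F p - (w - p) *: A) (F p) A p);
  last by move=> w; rewrite -(addrA (F w)) -opprD subrK.
have -> : e * h ^+ 2 = 4 * (2 ^+ m * (h / 2 ^+ m)) * (e / 8 * (2 * h)).
  by rewrite hE; field.
apply: rnorm_square_sum; first by rewrite divr_ge0 ?ltW// exprn_gt0.
rewrite hE => s' t' sx' ty'.
have wp : rnorm (s' +i* t' - p : R[i]^o) <= 2 * h.
  rewrite (le_trans (ler_rnormReIm _))//= mulr_natl mulr2n.
  by rewrite lerD// ler_norml; apply/andP; split; lra.
rewrite (le_trans (dP _ _))//; first by apply: (le_lt_trans wp); lra.
by rewrite ler_wpM2l// ltW.
Qed.

Lemma goursat_square F x y h : 0 < h ->
  (forall s t, x <= s <= x + h -> y <= t <= y + h ->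
    derivable (F : R[i]^o -> V) (s +i* t) 1) ->
  square_sum F m (h / 2 ^+ m) x y @[m --> \oo] --> 0.
Proof.
move=> h0 dF.
suff smallF e : 0 < e -> small F e h x y.
  apply/cvg_rnormP => e e0.
  have h20 : 0 < h ^+ 2 by rewrite exprn_gt0.
  have [m0 m0P] := smallF (e / h ^+ 2) (divr_gt0 e0 h20).
  exists m0 => // m /= /m0P; rewrite subr0 divfK// gt_eqF//.
move=> e0; apply: (dyadic_cousin (P := small F e)) => //.
  exact: small_split.
by move=> s t sx ty; apply: small_local => //; exact: dF.
Qed.

End Goursat.

(** * The mean value property *)

Section ComplexExponential.
Variable R : realType.
Implicit Types (w z : R[i]) (x y t : R).

Definition cexp w : R[i] := (expR (Re w))%:C * expi (Im w).

Lemma expiD x y : expi (x + y) = expi x * expi y.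
Proof.
by apply/eqP; rewrite /expi cosD sinD eq_complex /= eqxx addrC eqxx.
Qed.

Lemma rnorm_expi t : rnorm (expi t : R[i]^o) = 1.
Proof. by rewrite rnorm_complex /= cos2Dsin2 sqrtr1. Qed.

Lemma cexpD w z : cexp (w + z) = cexp w * cexp z.
Proof. by rewrite /cexp !raddfD /= expRD expiD rmorphM mulrACA. Qed.

Lemma rnorm_cexp w : rnorm (cexp w : R[i]^o) = expR (Re w).
Proof.
rewrite rnormcM rnorm_expi mulr1 rnorm_complex /= expr0n addr0 sqrtr_sqr.
by rewrite ger0_norm// expR_ge0.
Qed.

Lemma is_derive_approx (f : R -> R) x (l : R) : is_derive x 1 f l ->
  forall e, 0 < e -> exists2 d, 0 < d & forall h, `|h| < d ->
    `|f (x + h) - f x - h * l| <= e * `|h|.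
Proof.
move=> fl e e0.
have [df <-] := fl.
have /cvgrPdist_le/(_ e e0) := df.
rewrite -nbhs_nearE => /nbhs_normP[d /= d0 dP]; exists d => // h hd.
have [->|h0] := eqVneq h 0.
  by rewrite addr0 subrr mul0r subrr normr0 mulr0.
have := dP h; rewrite /= sub0r normrN => /(_ hd h0).
rewrite /shift /= [h *: 1]mulr1 -[lim _]/('D_1 f x) => H.
have -> : f (x + h) - f x - h * 'D_1 f x =
    - (h * ('D_1 f x - h^-1 * (f (h + x) - f x))).
  by rewrite mulrBr mulVKf// opprB (addrC h).
by rewrite normrN normrM mulrC ler_wpM2r.
Qed.

(** The derivative at [0] comes from the real derivatives of [expR], [cos] and [sin] there; the
    addition formula [cexpD] then carries it to every point. *)
Lemma cexp_approx0 (e : R) : 0 < e -> exists2 d : R, 0 < d & forall z,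
  rnorm (z : R[i]^o) < d ->
  rnorm (cexp z - 1 - z : R[i]^o) <= e * rnorm (z : R[i]^o).
Proof.
(* With [n] the norm of [z], the four error terms below are at most [c * n], [2 * (c * n)],
   [2 * (c * n)] and [c * n], hence the [6]. *)
move=> e0; pose c := e / 6; have c0 : 0 < c by rewrite divr_gt0.
have [d1 d10 h1] := is_derive_approx (is_derive_expR 0) c0.
have [d2 d20 h2] := is_derive_approx (is_derive_cos 0) c0.
have [d3 d30 h3] := is_derive_approx (is_derive_sin 0) c0.
(* Tolerance [1] gives [|X - 1| <= 2 * |x|] for [X = expR x]; the bounds [1 / 2] and [c / 2] on [n]
   then give [X <= 2] and [|X - 1| <= c]. *)
have [d4 d40 h4] := is_derive_approx (is_derive_expR 0) ltr01.
pose d := Num.min (Num.min (Num.min d1 d2) (Num.min d3 d4))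
  (Num.min (c / 2) (1 / 2)).
exists d.
  by rewrite !lt_min d10 d20 d30 d40 !divr_gt0.
move=> z; rewrite /d !lt_min.
move=> /andP[/andP[/andP[z1 z2] /andP[z3 z4]] /andP[z5 z6]].
have xz := normRe_le z; have yz := normIm_le z.
set n := rnorm _ in xz yz z1 z2 z3 z4 z5 z6 *.
have {}z6 : n < 1 / 2 := z6.
rewrite (le_trans (ler_rnormReIm _))//.
have := h1 (Re z) (le_lt_trans xz z1); rewrite add0r expR0 mulr1 => H1.
have := h2 (Im z) (le_lt_trans yz z2).
rewrite add0r cos0 sin0 oppr0 mulr0 subr0 => H2.
have := h3 (Im z) (le_lt_trans yz z3).
rewrite add0r cos0 sin0 subr0 mulr1 => H3.
have := h4 (Re z) (le_lt_trans xz z4); rewrite add0r expR0 mulr1 mul1r => H4.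
set X := expR (Re z) in H1 H4; set C := cos (Im z) in H2.
set S := sin (Im z) in H3.
have -> : Re (cexp z - 1 - z) = (X - 1 - Re z) + X * (C - 1).
  by rewrite /X /C /cexp; case: (z) => a b /=; ring.
have -> : Im (cexp z - 1 - z) = X * (S - Im z) + (X - 1) * Im z.
  by rewrite /X /S /cexp; case: (z) => a b /=; ring.
move: (Re z) (Im z) @X @C @S xz yz H1 H2 H3 H4 => x y X C S xz yz H1 H2 H3 H4.
have X0 : 0 < X by apply: expR_gt0.
have x_n : - n <= x <= n by rewrite -ler_norml.
have X2 : X <= 2.
  move: H4; rewrite ler_norml => /andP[_]; have := xz; move: `|x| => ax; lra.
have X1 : `|X - 1| <= c.
  have -> : X - 1 = X - 1 - x + x by ring.
  rewrite (le_trans (ler_normD _ _))//; move: H4 xz; lra.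
have -> : e * n = (c * n + 2 * (c * n)) + (2 * (c * n) + c * n).
  by rewrite /c; field.
have cn a : a <= n -> c * a <= c * n by move=> ?; rewrite ler_wpM2l// ltW.
have XM u : `|u| <= c * `|y| -> `|X * u| <= 2 * (c * n).
  move=> hu; rewrite normrM ger0_norm ?(ltW X0)// ler_pM ?(ltW X0)//.
  by rewrite (le_trans hu)// cn.
rewrite lerD// (le_trans (ler_normD _ _))// lerD//.
- by rewrite (le_trans H1)// cn.
- exact: XM.
- exact: XM.
- by rewrite normrM ler_pM.
Qed.

Lemma is_derive_cexp w :
  is_derive (w : R[i]^o) (1 : R[i]^o) (cexp : R[i]^o -> R[i]^o) (cexp w).
Proof.
apply: rnorm_derivable => e e0.
have c0 : 0 < expR (Re w) by apply: expR_gt0.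
have [d d0 dP] := cexp_approx0 (divr_gt0 e0 c0).
exists d => // z /dP zP.
have -> : cexp z - cexp w - (z - w) *: cexp w =
    cexp w * (cexp (z - w) - 1 - (z - w)).
  by rewrite 2!mulrBr -cexpD (addrC w) subrK mulr1 [_ *: _]mulrC.
rewrite rnormcM rnorm_cexp mulrC.
by rewrite -ler_pdivlMr// (le_trans zP)// mulrAC.
Qed.

End ComplexExponential.

(** The scalar field is a parameter because both [E]-valued and real-valued functions are averaged.
    Powers of two suit both bisection and midpoint convexity. *)
Definition circle_sum (R : realType) (K : numFieldType) (V : lmodType K)
    (u : R -> V) (m : nat) : V :=
  (2 ^+ m)^-1 *: \sum_(k < 2 ^ m) u (k%:R / 2 ^+ m * (2 * pi)).

Section MeanValue.
Variables (R : realType) (E : completeNormedModType R[i]).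
Implicit Types (gam : R[i] -> E) (z : R[i]) (m : nat).

Lemma closed_unit_discE z :
  closed_unit_disc z = (rnorm (z : R[i]^o) <= 1) :> Prop.
Proof. by rewrite /closed_unit_disc /= (normE (z : R[i]^o)) lecR. Qed.

Lemma circle_sumB (K : numFieldType) (V : lmodType K) (u v : R -> V) m :
  circle_sum (fun t => u t - v t) m = circle_sum u m - circle_sum v m.
Proof. by rewrite /circle_sum sumrB scalerBr. Qed.

Lemma circle_sum_cst (K : numFieldType) (V : lmodType K) (v : V) m :
  circle_sum (fun _ : R => v) m = v.
Proof.
rewrite /circle_sum sumr_const card_ord -[v *+ _]scaler_nat natrX scalerA.
by rewrite mulVf ?scale1r// expf_neq0.
Qed.

Lemma rnorm_circle_sum (u : R -> E) m (e : R) :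
  (forall t, rnorm (u t) <= e) -> rnorm (circle_sum u m) <= e.
Proof.
move=> ue; rewrite /circle_sum.
have -> : (2 ^+ m)^-1 = ((2 ^+ m)^-1)%:C :> R[i].
  by rewrite fmorphV rmorphXn /= rmorph_nat.
rewrite rnormZr ger0_norm ?invr_ge0 ?exprn_ge0//.
rewrite ler_pdivrMl ?exprn_gt0// (le_trans (rnorm_sum _ _ _))//.
rewrite (le_trans (ler_sum _ (G := fun=> e) _))// sumr_const card_ord.
by rewrite -[e *+ _]mulr_natl natrX.
Qed.

(** Goursat's theorem for [F] on the unit square between the abscissas [a - 1] and [a], which
    [w |-> cexp (2 * pi * w)] maps into the closed disc as [a <= 0]. The horizontal sides cancel
    since [F] has period ['i]; the vertical sides give the two circle means. *)
Let circle_sum_step gam (a : R) : a <= 0 ->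
  holomorphic_on (@closed_unit_disc R) gam ->
  circle_sum (fun t => gam (cexp ((2 * pi * a)%:C + t *i))) m -
  circle_sum (fun t => gam (cexp ((2 * pi * (a - 1))%:C + t *i))) m
    @[m --> \oo] --> (0 : E).
Proof.
move=> a0 hg; pose F (w : R[i]) := gam (cexp ((2 * pi)%:C * w)).
have dF (s t : R) : a - 1 <= s <= a - 1 + 1 -> 0 <= t <= 0 + 1 ->
    derivable (F : R[i]^o -> E) (s +i* t) 1.
  rewrite subrK => /andP[_ sa] _; apply/derivable1_diffP.
  apply: (@differentiable_comp _ (R[i]^o) (R[i]^o) _
    (fun w => cexp ((2 * pi)%:C * w))); last first.
    apply/derivable1_diffP; apply: hg.
    rewrite closed_unit_discE rnorm_cexp /= mul0r subr0.
    rewrite -expR0 ler_expR mulr_ge0_le0 ?mulr_ge0 ?pi_ge0//.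
    exact: le_trans sa a0.
  apply: (@differentiable_comp _ (R[i]^o) (R[i]^o) (R[i]^o)
    (fun w => (2 * pi)%:C * w)); last first.
    by apply/derivable1_diffP; apply: ex_derive; exact: is_derive_cexp.
  apply/derivable1_diffP; apply: derivableM; first exact: derivable_cst.
  exact: derivable_id.
have /cvg_rnormP sq := goursat_square ltr01 dF.
apply/cvg_rnormP => e /sq; apply: filterS => m; rewrite !subr0 => sm.
(* The factor [- 'i] undoes [dw = 'i dy] on the vertical sides and preserves the norm. *)
suff -> : circle_sum (fun t => gam (cexp ((2 * pi * a)%:C + t *i))) m -
    circle_sum (fun t => gam (cexp ((2 * pi * (a - 1))%:C + t *i))) m =
    - 'i *: square_sum F m (1 / 2 ^+ m) (a - 1) 0.
  by rewrite rnormZ normrN normc_def /= expr0n expr1n add0r sqrtr1 mul1r.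
have hE : 2 ^+ m * (1 / 2 ^+ m) = 1 :> R.
  by rewrite mulrCA divff ?mulr1// expf_neq0.
have per s : F (s +i* (0 + 1)) = F (s +i* 0).
  rewrite /F /cexp /= !mul0r !subr0 !addr0 !add0r mulr0 mulr1.
  congr (gam (_ * _)).
  by rewrite /expi mulr_natl cos2pi sin2pi cos0 sin0.
have -> : square_sum F m (1 / 2 ^+ m) (a - 1) 0 = (1 / 2 ^+ m)%:C *: ('i *:
    (\sum_(l < 2 ^ m) F (a +i* (l%:R / 2 ^+ m)) -
     \sum_(l < 2 ^ m) F ((a - 1) +i* (l%:R / 2 ^+ m)))).
  rewrite /square_sum hE; congr (_ *: _); set H := \sum_(l < _) _.
  have <- : H = \sum_(l < 2 ^ m) F ((a - 1 + l%:R * (1 / 2 ^+ m)) +i* (0 + 1)).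
    by apply: eq_bigr => l _; rewrite per.
  rewrite subrr add0r subrK; congr (_ *: (_ - _)).
    by apply: eq_bigr => l _; rewrite add0r mul1r.
  by apply: eq_bigr => l _; rewrite add0r mul1r.
have -> : (1 / 2 ^+ m)%:C = (2 ^+ m)^-1 :> R[i].
  by rewrite mul1r fmorphV rmorphXn /= rmorph_nat.
rewrite [RHS]scalerA [RHS]scalerA.
have -> (c : R[i]) : - ('i%C) / c * 'i%C = c^-1.
  by rewrite mulrAC mulNr -expr2 sqr_i opprK mul1r.
rewrite scalerBr.
rewrite /circle_sum /F; congr (_ *: _ - _ *: _); apply: eq_bigr => k _;
  congr (gam (cexp _)); apply/eqP; rewrite eq_complex /=;
  apply/andP; split; apply/eqP; ring.
Qed.

(** [S q] is the mean over the circle of radius [expR (- 2 * pi * q)]. Finitely many steps join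
    [S 0] to [S q], and for large [q] that circle lies where [gam] is close to [gam 0]. *)
Lemma circle_sum_holomorphic gam : holomorphic_on (@closed_unit_disc R) gam ->
  circle_sum (fun t => gam (expi t)) m @[m --> \oo] --> gam 0.
Proof.
move=> hg.
pose C (a : R) := circle_sum (fun t => gam (cexp ((2 * pi * a)%:C + t *i))).
pose S (q : nat) := C (- q%:R).
have SS q : S 0 m - S q m @[m --> \oo] --> 0.
  elim: q => [|q ih].
    apply/cvg_rnormP => e e0; apply: nearW => m.
    by rewrite subrr subr0 rnorm0 ltW.
  have q0 : - q%:R <= 0 :> R by rewrite oppr_le0.
  suff -> : (fun m => S 0 m - S q.+1 m) = (fun m => S 0 m - S q m) \+
      (fun m => S q m - C (- q%:R - 1) m).
    by rewrite -[X in _ --> X](addr0 0); exact: cvgD ih (circle_sum_step q0 hg).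
  apply/funext => m /=.
  by rewrite [RHS]addrA subrK /S -[in LHS]natr1 opprD.
(* The estimate is uniform in [t], so [q] can be fixed before [m] tends to infinity. *)
have g0 : forall e : R, 0 < e -> exists q, forall t,
    rnorm (gam (cexp ((2 * pi * - q%:R)%:C + t *i)) - gam 0) <= e.
  move=> e e0.
  have : {for (0 : R[i]^o), continuous (gam : R[i]^o -> E)}.
    apply: differentiable_continuous; apply/derivable1_diffP; apply: hg.
    by rewrite closed_unit_discE rnorm0.
  move=> /cvg_rnormP/(_ e e0); rewrite -nbhs_nearE => /nbhs_rnormP[d d0 dP].
  have [q qd] : exists q : nat, expR (- (q%:R)) < d.
    have /cvgrPdist_lt/(_ d d0)[q _ /(_ q (leqnn _))] := @cvgn_expR R.
    by rewrite sub0r normrN /= ger0_norm ?expR_ge0// => qd; exists q.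
  exists q => t; apply: dP; rewrite subr0 rnorm_cexp /=.
  apply: le_lt_trans qd; rewrite addr0 ler_expR.
  rewrite mulrN lerN2 ler_peMl//.
  have := pi_ge2 R; lra.
have S0 : S 0 = circle_sum (fun t => gam (expi t)).
  rewrite /S /C; congr circle_sum; apply/funext => t; congr gam.
  by rewrite /cexp /= oppr0 mulr0 addr0 expR0 mul1r add0r.
apply/cvg_rnormP => e e0.
have e20 : 0 < e / 2 by rewrite divr_gt0.
have [q qe] := g0 _ e20.
have /cvg_rnormP/(_ _ e20) := SS q.
apply: filterS => m; rewrite subr0 -S0 => h.
rewrite (le_trans (ler_rdistD (S q m) _ _))// [e]splitr lerD//.
rewrite -[gam 0](circle_sum_cst _ m) -circle_sumB.
exact: rnorm_circle_sum.
Qed.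

End MeanValue.

(** * Integral means of real functions: dyadic limits, strict monotonicity, rotations *)

Section CircleIntegral.
Variable R : realType.
Implicit Types (F G Phi : R -> R) (m : nat).

Definition circle_int F : R :=
  (2 * pi)^-1 * \int[lebesgue_measure]_(t in `[0, 2 * pi]) F t.

Let pi20 : 0 < 2 * pi :> R. Proof. by rewrite mulr_gt0 ?pi_gt0. Qed.

Let integrable_continuous F a b : continuous F ->
  lebesgue_measure.-integrable `[a, b] (EFin \o F).
Proof.
move=> cF; apply: continuous_compact_integrable; first exact: segment_compact.
exact: continuous_subspaceT.
Qed.

Lemma circle_mean_int (E : completeNormedModType R[i]) (f : E -> R)
    (gam : R[i] -> E) : continuous (fun t => f (gam (expi t))) ->
  circle_mean (fun x => (f x)%:E) gam =
  (circle_int (fun t => f (gam (expi t))))%:E.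
Proof.
move=> cf; rewrite /circle_mean /circle_int EFinM; congr (_ * _)%E.
rewrite /Rintegral fineK//; apply: integrable_fin_num => //.
exact: (integrable_continuous _ _ cf).
Qed.

Let continuous_derive_at Phi (x l : R) :
  is_derive x 1 Phi l -> {for x, continuous Phi}.
Proof.
by move=> [dP _]; apply/differentiable_continuous/derivable1_diffP.
Qed.

Lemma circle_int_primitive F Phi : continuous F ->
  (forall x, x \in `[0, 2 * pi] -> is_derive x 1 Phi (F x)) ->
  circle_int F = (2 * pi)^-1 * (Phi (2 * pi) - Phi 0).
Proof.
move=> cF dPhi; rewrite /circle_int /Rintegral (continuous_FTC2 (F := Phi) pi20)//.
- exact: continuous_subspaceT.
- split.
  + move=> x /subset_itv_oo_cc xI; have [] := dPhi x xI; by [].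
  + apply: cvg_at_right_filter; apply: continuous_derive_at (dPhi _ _).
    by rewrite in_itv /= lexx ltW.
  + apply: cvg_at_left_filter; apply: continuous_derive_at (dPhi _ _).
    by rewrite in_itv /= lexx ltW.
- move=> x /subset_itv_oo_cc xI; rewrite derive1E; have [_] := dPhi x xI; by [].
Qed.

(** Integrating from [-1] makes the derivative two-sided at the ends of [[0, 2 * pi]] as well. *)
Lemma exists_primitive F : continuous F ->
  exists Phi, forall x, x \in `]-1, (2 * pi + 1)[ -> is_derive x 1 Phi (F x).
Proof.
move=> cF; exists (fun x => \int[lebesgue_measure]_(t in `[-1, x]) F t) => x.
rewrite in_itv /= => /andP[x1 x2].
have [dF dE] := @continuous_FTC1_closed R F (-1) x (2 * pi + 1) x2
  (integrable_continuous _ _ cF) x1 (cF x).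
by split; [exact: dF|rewrite -derive1E].
Qed.

Let MVT_primitive F Phi (a b x h : R) :
  (forall y : R, y \in `]a, b[ -> is_derive y 1 Phi (F y)) ->
  0 < h -> a < x -> x + h < b ->
  exists2 c, x <= c <= x + h & Phi (x + h) - Phi x = h * F c.
Proof.
move=> dPhi h0 ax xb.
have xh : x < x + h by rewrite ltrDl.
have sub t : x <= t <= x + h -> t \in `]a, b[.
  rewrite in_itv /= => /andP[xt tx].
  by rewrite (lt_le_trans ax)// (le_lt_trans tx).
have dP t : t \in `]x, (x + h)[ ->
    is_derive (t : R^o) (1 : R^o) (Phi : R^o -> R^o) (F t).
  by rewrite in_itv /= => /andP[? ?]; apply/dPhi/sub/andP; split; exact: ltW.
have cP : {within `[x, x + h], continuous Phi}.
  apply: continuous_in_subspaceT => t; rewrite inE /= in_itv /= => tI.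
  exact: continuous_derive_at (dPhi _ (sub _ tI)).
have [c cI cE] := MVT xh dP cP.
exists c; last by rewrite cE addrAC subrr add0r mulrC.
by move: cI; rewrite in_itv /= => /andP[? ?]; rewrite !ltW.
Qed.

(** The error between a Riemann sum and the increment of a primitive is additive under bisection; on
    a short interval the mean value theorem bounds it by [e] times the length. *)
Lemma circle_sum_cvg_int F : continuous F ->
  circle_sum (F : R -> R^o) m @[m --> \oo] --> circle_int F.
Proof.
move=> cF; have [Phi dPhi] := exists_primitive cF.
have sub (x : R) : x \in `[0, (2 * pi)] -> x \in `](- 1), (2 * pi + 1)[.
  by rewrite !in_itv /= => /andP[? ?]; apply/andP; split; lra.
rewrite (circle_int_primitive cF (fun x xI => dPhi x (sub x xI))).
pose S h x m := h / 2 ^+ m * \sum_(k < 2 ^ m) F (x + k%:R * (h / 2 ^+ m)).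
have SS h x m : S h x m.+1 = S (h / 2) x m + S (h / 2) (x + h / 2) m.
  rewrite /S exprS invfM mulrA -mulrDr; congr (_ * _).
  rewrite expnS mul2n -addnn big_split_ord /=; congr (_ + _).
  apply: eq_bigr => k _; congr F; rewrite natrD natrX mulrDl addrA.
  by congr (_ + _ + _); rewrite mulrCA divff ?mulr1// expf_neq0.
suff SP e : 0 < e -> exists m0, forall m, (m0 <= m)%N ->
    `|S (2 * pi) 0 m - (Phi (0 + 2 * pi) - Phi 0)| <= e * (2 * pi).
  apply/cvgrPdist_le => e e0; have [m0 m0P] := SP _ e0; exists m0 => // m /= /m0P.
  have -> : circle_sum (F : R -> R^o) m = (2 * pi)^-1 * S (2 * pi) 0 m.
    rewrite /circle_sum /S mulrA mulrA mulVf ?gt_eqF// mul1r; congr (_ * _).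
    by apply: eq_bigr => k _; rewrite add0r mulrAC mulrA.
  rewrite add0r distrC -mulrBr normrM.
  rewrite [`|_^-1|]ger0_norm ?invr_ge0 ?(ltW pi20)// => h.
  by rewrite ler_pdivrMl// (le_trans h)// mulrC.
move=> e0.
(* [P] is constant in [y], which turns the bisection of squares into one of intervals. *)
pose P h x (y : R) := exists m0, forall m, (m0 <= m)%N ->
  `|S h x m - (Phi (x + h) - Phi x)| <= e * h.
apply: (dyadic_cousin (P := P) (y := 0)) => //.
  move=> h x y k [m1 h1] [m2 h2] _ _; exists (maxn m1 m2).+1 => -[//|m].
  rewrite ltnS geq_max => /andP[/h1{}h1 /h2{}h2]; rewrite SS -/k.
  have kh : h = k + k by rewrite /k -splitr.
  have -> : S k x m + S k (x + k) m - (Phi (x + h) - Phi x) =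
    (S k x m - (Phi (x + k) - Phi x)) +
    (S k (x + k) m - (Phi (x + k + k) - Phi (x + k))).
    by rewrite kh addrA; ring.
  by rewrite (le_trans (ler_normD _ _))// [in leRHS]kh mulrDr lerD.
move=> s t sI tI.
have e20 : 0 < e / 2 by rewrite divr_gt0.
have /cvgrPdist_le/(_ _ e20) := cF s.
rewrite -nbhs_nearE => /nbhs_normP[d /= d0 dP].
(* The bound [1] keeps [[x, x + h]] inside []-1, 2 * pi + 1[], where [Phi] is a primitive. *)
exists (Num.min d 1); first by rewrite lt_min d0 ltr01.
move=> h x y h0; rewrite lt_min => /andP[hd h1] /andP[xs sx] _; exists 0 => m _.
have Fs c : x <= c <= x + h -> `|F s - F c| <= e / 2.
  move=> /andP[? ?]; apply: dP => /=; rewrite (le_lt_trans _ hd)// ler_norml.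
  by apply/andP; split; lra.
have ax : -1 < x by move: sI => /andP[? ?]; lra.
have xb : x + h < 2 * pi + 1 by move: sI => /andP[? ?]; lra.
have [c cI ->] := MVT_primitive dPhi h0 ax xb.
have Fc u : x <= u <= x + h -> `|F u - F c| <= e.
  move=> uI; rewrite (le_trans (ler_distD (F s) _ _))// [e]splitr lerD ?Fs//.
  by rewrite distrC Fs.
have -> : h * F c = h / 2 ^+ m * \sum_(k < 2 ^ m) F c.
  by rewrite sumr_const card_ord -[F c *+ _]mulr_natl natrX mulrA divfK.
rewrite /S -mulrBr -sumrB normrM ger0_norm ?divr_ge0 ?exprn_ge0 ?(ltW h0)//.
rewrite mulrAC ler_pdivrMr ?exprn_gt0// (mulrC e) -mulrA ler_wpM2l ?(ltW h0)//.
rewrite (le_trans (ler_norm_sum _ _ _))//.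
rewrite (le_trans (ler_sum _ (G := fun=> e) _))//.
  move=> k _; apply: Fc; rewrite lerDl mulr_ge0 ?divr_ge0 ?exprn_ge0 ?(ltW h0)//=.
  rewrite lerD2l mulrA ler_pdivrMr ?exprn_gt0// mulrC ler_wpM2l ?(ltW h0)//.
  by rewrite -natrX ler_nat ltnW.
by rewrite sumr_const card_ord -[e *+ _]mulr_natr natrX.
Qed.

Lemma le_circle_int F G : continuous F -> continuous G ->
  (forall t, F t <= G t) -> circle_int F <= circle_int G.
Proof.
move=> cF cG FG; rewrite /circle_int ler_wpM2l ?invr_ge0 ?(ltW pi20)//.
by apply: le_Rintegral => //; exact: integrable_continuous.
Qed.

(** The difference [H] of two primitives is nondecreasing by the mean value theorem. It increases
    strictly over [[u, v]], a neighbourhood of [t0] cut to [[0, 2 * pi]], where [G - F] stays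
    positive by continuity. *)
Lemma lt_circle_int F G t0 : continuous F -> continuous G ->
  (forall t, F t <= G t) -> t0 \in `[0, 2 * pi] -> F t0 < G t0 ->
  circle_int F < circle_int G.
Proof.
move=> cF cG FG; rewrite in_itv /= => /andP[t00 t02] FGt0.
have [PF dPF] := exists_primitive cF; have [PG dPG] := exists_primitive cG.
have sub (x : R) : x \in `[0, (2 * pi)] -> x \in `](- 1), (2 * pi + 1)[.
  by rewrite !in_itv /= => /andP[? ?]; apply/andP; split; lra.
rewrite (circle_int_primitive cF (fun x xI => dPF x (sub x xI))).
rewrite (circle_int_primitive cG (fun x xI => dPG x (sub x xI))).
rewrite ltr_pM2l ?invr_gt0//.
pose D := G \- F; pose H := PG \- PF.
have dH x : x \in `](- 1), (2 * pi + 1)[ -> is_derive x 1 H (D x).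
  by move=> xI; apply: is_deriveB; [exact: dPG|exact: dPF].
have HM x y : 0 <= x -> x < y -> y <= 2 * pi ->
    exists2 c, x <= c <= y & H y - H x = (y - x) * D c.
  move=> x0 xy y2; have yx : 0 < y - x by rewrite subr_gt0.
  have ax : -1 < x by lra.
  have xb : x + (y - x) < 2 * pi + 1 by lra.
  have [c cI cE] := MVT_primitive dH yx ax xb.
  by exists c; rewrite addrC subrK in cI cE.
have Hmono x y : 0 <= x -> x <= y -> y <= 2 * pi -> H x <= H y.
  move=> x0; rewrite le_eqVlt => /predU1P[->//|xy] y2.
  have [c _ cE] := HM _ _ x0 xy y2; rewrite -subr_ge0 cE mulr_ge0//.
    by rewrite subr_ge0 ltW.
  by rewrite /D /= subr_ge0.
have Dt0 : 0 < D t0 by rewrite /D /= subr_gt0.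
have cD : {for t0, continuous D} by apply: continuousB; [exact: cG|exact: cF].
have /cvgrPdist_lt/(_ _ Dt0) := cD.
rewrite -nbhs_nearE => /nbhs_normP[d /= d0 dP].
pose u := Num.max 0 (t0 - d / 2); pose v := Num.min (2 * pi) (t0 + d / 2).
have u0 : 0 <= u by rewrite le_max lexx.
have v2 : v <= 2 * pi by rewrite ge_min lexx.
have ut : u <= t0 by rewrite ge_max t00/=; lra.
have tv : t0 <= v by rewrite le_min t02/=; lra.
have p0 := pi20.
have uv : u < v.
  by rewrite /u /v gt_max !lt_min; apply/andP; split; apply/andP; split; lra.
have ud : t0 - d / 2 <= u by rewrite le_max lexx orbT.
have vd : v <= t0 + d / 2 by rewrite ge_min lexx orbT.
suff : H 0 < H (2 * pi) by rewrite /H /=; lra.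
have [c /andP[uc cv] cE] := HM _ _ u0 uv v2.
apply: (@le_lt_trans _ _ (H u)); first by apply: Hmono => //; lra.
apply: (@lt_le_trans _ _ (H v)); last by apply: Hmono => //; lra.
rewrite -subr_gt0 cE mulr_gt0 ?subr_gt0//.
have h1 : `|t0 - c| < d by rewrite ltr_norml; apply/andP; split; lra.
have : `|D t0 - D c| < D t0 := dP c h1.
by rewrite ltr_norml => /andP[_]; rewrite ltrBlDr ltrDl subr_gt0.
Qed.

Lemma circle_int_affine_cos (a b : R) : circle_int (fun t => a + b * cos t) = a.
Proof.
have cF : continuous (fun t : R => a + b * cos t).
  move=> t; apply: cvgD; first exact: cvg_cst.
  by apply: cvgM; [exact: cvg_cst|exact: continuous_cos].
have dP (x : R) : x \in `[0, 2 * pi] ->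
    is_derive x 1 (fun t => a * t + b * sin t) (a + b * cos x).
  move=> _; rewrite -[a in a + b * _]mulr1.
  exact: (is_deriveD (is_deriveZ a (is_derive_id x 1))
    (is_deriveZ b (is_derive_sin x))).
rewrite (circle_int_primitive cF dP).
rewrite mulr_natl sin2pi sin0 !mulr0 !addr0 subr0 -mulr_natl mulrCA.
rewrite mulVf ?mulr1//.
by rewrite gt_eqF.
Qed.

(** Each unit shift trades the term [a p] for [a (N + p)], which is equal to it. *)
Let sum_cycle (a : nat -> R) (N p : nat) : (forall i, a (i + N)%N = a i) ->
  \sum_(i < N) a (i + p)%N = \sum_(i < N) a i.
Proof.
move=> aN; elim: p => [|p <-]; first by under eq_bigr do rewrite addn0.
apply: (addrI (a p)); rewrite [RHS]addrC -[in RHS](aN p) [in RHS](addnC p).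
have <- : \sum_(i < N.+1) a (i + p)%N = \sum_(i < N) a (i + p)%N + a (N + p)%N.
  by rewrite big_ord_recr.
rewrite big_ord_recl; congr (_ + _).
by apply: eq_bigr => i _; rewrite lift0 addSn addnS.
Qed.

(** A rotation by [j / 2 ^+ k] of a turn permutes the [2 ^ (m + k)]-th roots of unity: it shifts
    indices by [j * 2 ^ m]. *)
Let circle_sum_shift F (j k m : nat) : (forall t, F (t + 2 * pi) = F t) ->
  circle_sum (fun t => F (t + j%:R / 2 ^+ k * (2 * pi)) : R^o) (m + k) =
  circle_sum (F : R -> R^o) (m + k).
Proof.
move=> Fper; rewrite /circle_sum; congr (_ *: _).
have n0 n : 2 ^+ n != 0 :> R by rewrite expf_neq0.
pose a i := F (i%:R / 2 ^+ (m + k) * (2 * pi)).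
rewrite -(@sum_cycle a (2 ^ (m + k)) (j * 2 ^ m)%N) => [|i]; last first.
  by rewrite /a natrD natrX mulrDl divff// mulrDl mul1r.
apply: eq_bigr => i _; congr F; rewrite -mulrDl; congr (_ * _).
rewrite natrD natrM natrX mulrDl; congr (_ + _).
by rewrite exprD invfM (mulrC (2 ^+ m)^-1) mulrACA divff// mulr1.
Qed.

(** For a dyadic rotation the circle sums of order at least [k] agree exactly, so the integrals
    agree in the limit. *)
Lemma circle_int_half_shift F (j k : nat) : continuous F ->
  (forall t, F (t + 2 * pi) = F t) ->
  circle_int (fun t => (F t + F (t + j%:R / 2 ^+ k * (2 * pi))) / 2) =
  circle_int F.
Proof.
move=> cF Fper; set s := j%:R / 2 ^+ k * (2 * pi).
have cG : continuous (fun t => (F t + F (t + s)) / 2).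
  move=> t; apply: cvgM; last exact: cvg_cst.
  apply: cvgD; first exact: cF.
  apply: (@continuous_comp _ _ _ (fun t => t + s) F); last exact: cF.
  by apply: cvgD; [exact: cvg_id|exact: cvg_cst].
apply/esym/(@cvg_unique _ _ (circle_sum (F : R -> R^o) m @[m --> \oo])).
- exact: norm_hausdorff.
- exact: circle_sum_cvg_int cF.
have := circle_sum_cvg_int cG; apply: cvg_trans; apply: near_eq_cvg.
exists k => // m /= km; rewrite -(subnK km).
have := circle_sum_shift j k (m - k) Fper; rewrite -/s /circle_sum => h.
rewrite -mulr_suml big_split /=; move: h.
have c0 : (2 ^+ (m - k + k))^-1 != 0 :> R by rewrite invr_neq0// expf_neq0.
by move=> /(scalerI c0) ->; rewrite mulrDl -splitr.
Qed.

End CircleIntegral.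

(** * Convexity and plurisubharmonicity *)

Lemma continuous_expi (R : realType) : continuous (@expi R : R -> R[i]^o).
Proof.
move=> t; apply/cvg_rnormP => e e0.
have e20 : 0 < e / 2 by rewrite divr_gt0.
have /cvgrPdist_le/(_ _ e20) := @continuous_cos R t.
have /cvgrPdist_le/(_ _ e20) := @continuous_sin R t.
apply: filterS2 => s hs hc; rewrite (le_trans (ler_rnormReIm _))//=.
by rewrite [e]splitr lerD// distrC.
Qed.

(** From here on, holomorphy means complex differentiability of an extension at each point of the
    closed disc. *)
Lemma holomorphic_disc_closed (R : realType) (E : completeNormedModType R[i])
    (gam : R[i] -> E) : holomorphic_disc gam ->
  exists2 del, holomorphic_on (@closed_unit_disc R) del &
    forall z, closed_unit_disc z -> gam z = del z.
Proof. by move=> [U [del [_ UD hU gd]]]; exists del => // z /UD /hU. Qed.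

Lemma continuous_expi_comp (R : realType) (E : completeNormedModType R[i])
    (gam : R[i] -> E) : holomorphic_on (@closed_unit_disc R) gam ->
  continuous (fun t => gam (expi t)).
Proof.
move=> hg t; apply: (@continuous_comp _ (R[i]^o) _ (@expi R) gam).
  exact: continuous_expi.
apply/differentiable_continuous/derivable1_diffP/hg.
by rewrite closed_unit_discE rnorm_expi.
Qed.

(** * Convex implies plurisubharmonic *)

Section RealStructure.
Variables (R : realType) (E : completeNormedModType R[i]) (sigma piR : E -> E).
Hypotheses (sigma_antilinear : antilinear sigma)
  (sigma_continuous : continuous sigma)
  (piR_projection : projection_along (fixed_space sigma)
                      (times_i (fixed_space sigma)) piR).
Implicit Types (x y v : E) (r : R) (z : R[i]).

Let sigmaD : {morph sigma : x y / x + y} := sigma_antilinear.1.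
Let sigmaZ z x : sigma (z *: x) = z^*%C *: sigma x := sigma_antilinear.2 z x.

Let sigmaN x : sigma (- x) = - sigma x.
Proof. by rewrite -scaleN1r sigmaZ rmorphN1 scaleN1r. Qed.

Lemma projection_fixed x : sigma (piR x) = piR x.
Proof. by have [] := piR_projection x. Qed.

(** [sigma] fixes [piR x] and negates [x - piR x]. The formula makes real linearity and continuity
    of [piR] visible. *)
Lemma projectionE x : piR x = 2^-1 *: (x + sigma x).
Proof.
have [/= p1 [y /= y1 xE]] := piR_projection x.
have : sigma (x - piR x) = - (x - piR x).
  rewrite -xE sigmaZ y1 -scaleNr; congr (_ *: _).
  by apply/eqP; rewrite eq_complex /= oppr0 !eqxx.
rewrite sigmaD sigmaN p1 => /eqP; rewrite opprB subr_eq => /eqP ->.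
rewrite addrA (addrC x) subrK -mulr2n -[piR x *+ 2]scaler_nat.
by rewrite scalerA mulVf ?scale1r.
Qed.

Lemma projection_id x : sigma x = x -> piR x = x.
Proof.
move=> sx; rewrite projectionE sx -mulr2n -[x *+ 2]scaler_nat.
by rewrite scalerA mulVf ?scale1r.
Qed.

Lemma projectionD : {morph piR : x y / x + y}.
Proof. by move=> x y; rewrite !projectionE -scalerDr sigmaD addrACA. Qed.

Lemma projectionZ z x : sigma x = x -> piR (z *: x) = (Re z)%:C *: x.
Proof.
move=> sx; rewrite projectionE sigmaZ sx -scalerDl scalerA ReJ_add.
by rewrite mulrC.
Qed.

Lemma projectionZr r x : piR (r%:C *: x) = r%:C *: piR x.
Proof. by rewrite !projectionE sigmaZ conjc_real -scalerDr !scalerA mulrC. Qed.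

Lemma projection_continuous : continuous piR.
Proof.
move=> x; rewrite (_ : piR = fun x => 2^-1 *: (x + sigma x)); last first.
  by apply/funext => y; rewrite projectionE.
by apply: cvgZr; apply: cvgD; [exact: cvg_id|exact: sigma_continuous].
Qed.

Lemma fixed_scale r x : sigma x = x -> sigma (r%:C *: x) = r%:C *: x.
Proof. by move=> sx; rewrite sigmaZ conjc_real sx. Qed.

Lemma fixedD x y : sigma x = x -> sigma y = y -> sigma (x + y) = x + y.
Proof. by move=> sx sy; rewrite sigmaD sx sy. Qed.

Lemma projection_circle_sum (u : R -> E) m :
  piR (circle_sum u m) = circle_sum (piR \o u) m.
Proof.
rewrite /circle_sum.
have -> : (2 ^+ m)^-1 = ((2 ^+ m)^-1)%:C :> R[i].
  by rewrite fmorphV rmorphXn /= rmorph_nat.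
rewrite projectionZr; congr (_ *: _).
apply: (big_morph _ projectionD); apply: projection_id.
by rewrite -(scale0r (0 : E)) sigmaZ conjc0 !scale0r.
Qed.

Variable fR : E -> R.
Hypothesis fR_continuous : {within fixed_space sigma, continuous fR}.

(** [fR] is continuous only relative to the fixed space, but [piR] takes all its values there. *)
Lemma continuous_projection_comp : continuous (fR \o piR).
Proof.
move=> x.
have /subspace_continuousP/(_ (piR x) (projection_fixed x)) := fR_continuous.
move=> cf A /cf Ax.
have : nbhs x (piR @^-1` [set y | fixed_space sigma y -> A (fR y)]).
  by apply: projection_continuous; exact: Ax.
by apply: filterS => y h; exact: h (projection_fixed y).
Qed.

Lemma segment_between x y : sigma x = x -> sigma y = y ->
  exists gam, [/\ segment_in (fixed_space sigma) gam, gam (-1) = x, gam 1 = y &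
    gam 0 = 2^-1 *: (x + y)].
Proof.
move=> sx sy.
exists (fun s => ((1 - s) / 2)%:C *: x + ((1 + s) / 2)%:C *: y).
have half (u : R) : u = 2 -> (u / 2)%:C = 1 :> R[i] by move=> ->; rewrite divff.
have c2 : (1 / 2)%:C = 2^-1 :> R[i] by rewrite mul1r fmorphV rmorph_nat.
split.
- split=> [s t l _ _ _|s _]; last by apply: fixedD; exact: fixed_scale.
  rewrite !scalerDr !scalerA addrACA -!scalerDl -!rmorphM -!rmorphD.
  by congr (_%:C *: _ + _%:C *: _); field.
- rewrite subrr mul0r scale0r addr0 half ?scale1r//; lra.
- rewrite subrr mul0r scale0r add0r half ?scale1r//; lra.
- by rewrite subr0 addr0 c2 scalerDr.
Qed.

Definition midpoint_convex := forall x y, sigma x = x -> sigma y = y ->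
  fR (2^-1 *: (x + y)) <= (fR x + fR y) / 2.

Lemma convex_midpoint : convex_fun (fixed_space sigma) fR -> midpoint_convex.
Proof.
move=> [_ cvx] x y sx sy; have [gam [sg gN1 g1 g0]] := segment_between sx sy.
by rewrite -g0 -[in leRHS]gN1 -[in leRHS]g1; exact: cvx.
Qed.

Lemma strictly_convex_midpoint : strictly_convex_fun (fixed_space sigma) fR ->
  forall x y, sigma x = x -> sigma y = y -> x != y ->
  fR (2^-1 *: (x + y)) < (fR x + fR y) / 2.
Proof.
move=> [_ cvx] x y sx sy xy; have [gam [sg gN1 g1 g0]] := segment_between sx sy.
rewrite -g0 -[in ltRHS]gN1 -[in ltRHS]g1; apply: cvx => //; exists (-1), 1.
by rewrite gN1 g1 !in_itv /=; split => //; apply/andP; split; lra.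
Qed.

(** By induction: the mean of [2 ^ m.+1] points is the midpoint of the means of the two halves. *)
Lemma jensen_dyadic m (x : nat -> E) : midpoint_convex ->
  (forall k, sigma (x k) = x k) ->
  fR ((2 ^+ m)^-1 *: \sum_(k < 2 ^ m) x k) <=
  (2 ^+ m)^-1 * \sum_(k < 2 ^ m) fR (x k).
Proof.
move=> cvx; elim: m x => [|m ih] x sx.
  by rewrite !expr0 !invr1 scale1r mul1r !big_ord1.
rewrite expnS mul2n -addnn !big_split_ord /= !exprS !invfM -scalerA scalerDr.
have sav (y : nat -> E) : (forall k, sigma (y k) = y k) ->
    sigma ((2 ^+ m)^-1 *: \sum_(k < 2 ^ m) y k) =
    (2 ^+ m)^-1 *: \sum_(k < 2 ^ m) y k.
  move=> sy; have -> : (2 ^+ m)^-1 = ((2 ^+ m)^-1)%:C :> R[i].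
    by rewrite fmorphV rmorphXn /= rmorph_nat.
  apply: fixed_scale; rewrite (big_morph _ sigmaD (_ : sigma 0 = 0)).
    by apply: eq_bigr.
  by rewrite -(scale0r (0 : E)) sigmaZ conjc0 !scale0r.
apply: (le_trans (cvx _ _ (sav _ sx) (sav (fun k => x (2 ^ m + k)%N) _))) => //.
rewrite -mulrA [leRHS]mulrC ler_pM2r ?invr_gt0// mulrDr lerD ?ih//.
exact: (ih (fun k => x (2 ^ m + k)%N)).
Qed.

Lemma jensen_circle (u : R -> E) (p : E) : midpoint_convex ->
  (forall t, sigma (u t) = u t) -> sigma p = p ->
  continuous (fun t => fR (u t)) ->
  circle_sum u m @[m --> \oo] --> p ->
  fR p <= circle_int (fun t => fR (u t)).
Proof.
move=> cvx su sp cf up.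
(* The limit is taken through [fR \o piR], which is continuous on all of [E] and equals [fR] on
   fixed vectors. *)
have fup : fR (piR (circle_sum u m)) @[m --> \oo] --> fR (piR p).
  exact: (cvg_comp _ _ up (@continuous_projection_comp p)).
rewrite -(projection_id sp).
apply: (ler_cvg_to fup (circle_sum_cvg_int cf)); apply: nearW => m.
rewrite projection_circle_sum /circle_sum.
under [in leLHS]eq_bigr do rewrite /= projection_id//.
exact: (@jensen_dyadic m (fun k => u (k%:R / 2 ^+ m * (2 * pi)))).
Qed.

Lemma continuous_circle (gam : R[i] -> E) :
  holomorphic_on (@closed_unit_disc R) gam ->
  continuous (fun t => fR (piR (gam (expi t)))).
Proof.
move=> hg t.
apply: (@continuous_comp _ _ _ (fun t => gam (expi t)) (fR \o piR));
  last exact: continuous_projection_comp.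
exact: continuous_expi_comp.
Qed.

Lemma midpoint_convex_disc (gam : R[i] -> E) : midpoint_convex ->
  holomorphic_on (@closed_unit_disc R) gam ->
  fR (piR (gam 0)) <= circle_int (fun t => fR (piR (gam (expi t)))).
Proof.
move=> cvx hg; apply: jensen_circle => //.
- by move=> t; exact: projection_fixed.
- exact: projection_fixed.
- exact: continuous_circle.
- suff -> : circle_sum (fun t => piR (gam (expi t))) =
      (fun m => piR (circle_sum (fun t => gam (expi t)) m)).
    exact: (cvg_comp _ _ (circle_sum_holomorphic hg)
      (@projection_continuous (gam 0))).
  by apply/funext => m; rewrite projection_circle_sum.
Qed.

Lemma midpoint_convex_psh : midpoint_convex ->
  plurisubharmonic (fun x => (fR (piR x))%:E).
Proof.
move=> cvx; split.
- by [].
- move=> x a /=; rewrite lte_fin => ax.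
  have /cvgrPdist_lt/(_ (- fR (piR x) - a)) := @continuous_projection_comp x.
  rewrite subr_gt0 => /(_ ax); rewrite -nbhs_nearE => h.
  exists [set y | `|fR (piR x) - fR (piR y)| < - fR (piR x) - a]; first exact: h.
  by move=> y /=; rewrite lte_fin ltr_norml => /andP[? _]; lra.
move=> gam /holomorphic_disc_closed[del hd gd].
have g1 t : gam (expi t) = del (expi t).
  by apply: gd; rewrite closed_unit_discE rnorm_expi.
have gE : (fun t => fR (piR (gam (expi t)))) =
    (fun t => fR (piR (del (expi t)))).
  by apply/funext => t; rewrite g1.
rewrite (@circle_mean_int _ _ (fR \o piR)) /= gE; last exact: continuous_circle.
rewrite lee_fin gd ?closed_unit_discE ?rnorm0//.
exact: midpoint_convex_disc.
Qed.

End RealStructure.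

(* If h minus its chord had a positive maximum on [-1, 1], the mean inequality
   on the largest circle around a maximizer would reach -1 or 1, where it
   vanishes. *)
Lemma circle_mean_chord (R : realType) (h : R -> R) : continuous h ->
  (forall c r : R, h c <= circle_int (fun t => h (c + r * cos t))) ->
  forall c, c \in `[-1, 1] ->
  h c <= (h 1 + h (-1)) / 2 + (h 1 - h (-1)) / 2 * c.
Proof.
move=> ch mh; pose L c := (h 1 + h (-1)) / 2 + (h 1 - h (-1)) / 2 * c.
pose k c := h c - L c.
have cL : continuous L.
  move=> c; apply: cvgD; first exact: cvg_cst.
  by apply: cvgM; [exact: cvg_cst|exact: cvg_id].
have ck : continuous k by move=> c; apply: cvgB; [exact: ch|exact: cL].
have N11 : -1 <= 1 :> R by lra.
have [s0 s0I kmax] := EVT_max N11 (continuous_subspaceT ck).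
suff k0 : k s0 <= 0.
  by move=> c /kmax kc; rewrite -subr_le0 (le_trans kc).
rewrite leNgt; apply/negP => M0.
have k1 : k 1 = 0 by rewrite /k /L; lra.
have kN1 : k (-1) = 0 by rewrite /k /L; lra.
have Ls r t : L (s0 + r * cos t) = L s0 + (h 1 - h (-1)) / 2 * r * cos t.
  by rewrite /L; ring.
move: s0I; rewrite in_itv /= => /andP[s0N1 s01].
pose r := 1 - `|s0|.
have r0 : 0 <= r by rewrite subr_ge0 ler_norml s0N1.
have cI (t : R) : s0 + r * cos t \in `[-1, 1].
  have : `|s0 + r * cos t| <= 1.
    rewrite (le_trans (ler_normD _ _))// normrM (ger0_norm r0).
    rewrite -lerBrDl -/r ler_piMr//.
    by rewrite ler_norml cos_geN1 cos_le1.
  by rewrite ler_norml in_itv.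
have ccos : continuous (fun t : R => s0 + r * cos t).
  move=> t; apply: cvgD; first exact: cvg_cst.
  by apply: cvgM; [exact: cvg_cst|exact: continuous_cos].
have chc : continuous (fun t => h (s0 + r * cos t)).
  by move=> t; apply: (@continuous_comp _ _ _ (fun t => s0 + r * cos t) h);
    [exact: ccos|exact: ch].
(* [G t] is [k s0 + L (s0 + r * cos t)], and its circle mean is [k s0 + L s0 = h s0]. *)
pose G t := (k s0 + L s0) + (h 1 - h (-1)) / 2 * r * cos t.
have cG : continuous G.
  move=> t; apply: cvgD; first exact: cvg_cst.
  by apply: cvgM; [exact: cvg_cst|exact: continuous_cos].
have FG t : h (s0 + r * cos t) <= G t.
  by have := kmax _ (cI t); rewrite {1}/k Ls /G; lra.
have p0 := pi_gt0 R.
(* The circle reaches [1] at angle [0] if [s0 >= 0], and [-1] at angle [pi] otherwise. *)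
have [t0 t0I kt0] : exists2 t0, t0 \in `[0, 2 * pi] & k (s0 + r * cos t0) = 0.
  have [s0p|s0n] := leP 0 s0.
    exists 0; first by rewrite in_itv /=; apply/andP; split; lra.
    by rewrite cos0 /r ger0_norm// -[RHS]k1; congr k; ring.
  exists pi; first by rewrite in_itv /=; apply/andP; split; lra.
  by rewrite cospi /r ltr0_norm// -[RHS]kN1; congr k; ring.
have FGt0 : h (s0 + r * cos t0) < G t0.
  by move: kt0; rewrite {1}/k Ls /G; lra.
have := lt_circle_int chc cG FG t0I FGt0.
rewrite circle_int_affine_cos /k subrK ltNge.
by rewrite mh.
Qed.

(** * Plurisubharmonic implies convex, tested on affine discs *)

Section PshConvex.
Variables (R : realType) (E : completeNormedModType R[i]) (sigma piR : E -> E).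
Hypotheses (sigma_antilinear : antilinear sigma)
  (sigma_continuous : continuous sigma)
  (piR_projection : projection_along (fixed_space sigma)
                      (times_i (fixed_space sigma)) piR).
Variable fR : E -> R.
Hypothesis fR_continuous : {within fixed_space sigma, continuous fR}.

(** For fixed vectors [a] and [v], [piR] flattens this disc onto the real line through [a] along
    [v]; the unit circle goes to the parameters [c + r * cos t]. *)
Let disc (a v : E) (c r : R) (z : R[i]) : E := a + (c%:C + r%:C * z) *: v.

Let disc_holomorphic a v c r : holomorphic_disc (disc a v c r).
Proof.
exists setT, (disc a v c r); split => //; first exact: openT.
move=> z _; apply: ex_derive; apply: (@rnorm_derivable _ _ _ _ (r%:C *: v)).
move=> e e0; exists 1 => // w _.
rewrite /disc opprD addrACA subrr add0r -scalerBl opprD addrACA subrr add0r.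
by rewrite -mulrBr scalerA [_ * r%:C]mulrC subrr rnorm0 mulr_ge0 ?rnorm_ge0 ?ltW.
Qed.

Let line_continuous a v : sigma a = a -> sigma v = v ->
  continuous (fun s : R => fR (a + s%:C *: v)).
Proof.
move=> sa sv.
have -> : (fun s : R => fR (a + s%:C *: v)) =
    (fR \o piR) \o (fun s : R => a + s%:C *: v).
  apply/funext => s /=; rewrite (projection_id sigma_antilinear piR_projection)//.
  by apply: fixedD => //; exact: fixed_scale.
move=> s; apply: continuous_comp; last first.
  exact: (continuous_projection_comp sigma_antilinear sigma_continuous
    piR_projection fR_continuous).
apply/cvg_rnormP => e e0.
have v0 : 0 < rnorm v + 1 by rewrite ltr_pwDr// rnorm_ge0.
have /cvgrPdist_le/(_ _ (divr_gt0 e0 v0)) : id x @[x --> s] --> s by exact: cvg_id.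
apply: filterS => x /= xs.
rewrite opprD addrACA subrr add0r -scalerBl -rmorphB rnormZr distrC.
rewrite ler_pdivlMr// in xs; rewrite (le_trans _ xs)// ler_wpM2l//.
by rewrite lerDl.
Qed.

Let disc_circle a v c r t : sigma a = a -> sigma v = v ->
  piR (disc a v c r (expi t)) = a + (c + r * cos t)%:C *: v.
Proof.
move=> sa sv; rewrite /disc (projectionD sigma_antilinear piR_projection).
rewrite (projection_id sigma_antilinear piR_projection)//.
rewrite (projectionZ sigma_antilinear piR_projection)//.
by congr (_ + _%:C *: _); rewrite /expi /=; ring.
Qed.

Let f (x : E) : \bar R := (fR (piR x))%:E.

Let disc_mean a v c r : sigma a = a -> sigma v = v ->
  circle_mean f (disc a v c r) =
  (circle_int (fun t => fR (a + (c + r * cos t)%:C *: v)))%:E.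
Proof.
move=> sa sv.
have E1 : (fun t => fR (piR (disc a v c r (expi t)))) =
    (fun t => fR (a + (c + r * cos t)%:C *: v)).
  by apply/funext => t; rewrite disc_circle.
rewrite /f (@circle_mean_int _ _ (fR \o piR)) /= E1//.
move=> t; apply: (@continuous_comp _ _ _ (fun t => c + r * cos t)
  (fun s : R => fR (a + s%:C *: v))); last exact: line_continuous.
apply: cvgD; first exact: cvg_cst.
by apply: cvgM; [exact: cvg_cst|exact: continuous_cos].
Qed.

Let psh_line a v c r : sigma a = a -> sigma v = v -> plurisubharmonic f ->
  fR (a + c%:C *: v) <= circle_int (fun t => fR (a + (c + r * cos t)%:C *: v)).
Proof.
move=> sa sv [_ _ /(_ _ (disc_holomorphic a v c r))].
rewrite disc_mean// lee_fin /disc mulr0 addr0.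
rewrite (projection_id sigma_antilinear piR_projection)//.
by apply: fixedD => //; exact: fixed_scale.
Qed.

Let segment_line gam : segment_in (fixed_space sigma) gam ->
  exists a v, [/\ sigma a = a, sigma v = v &
    forall s, s \in `[-1, 1] -> gam s = a + s%:C *: v].
Proof.
move=> [ga gs].
have I0 : (0 : R) \in `[-1, 1] by rewrite in_itv /=; apply/andP; split; lra.
have I1 : (1 : R) \in `[-1, 1] by rewrite in_itv /=; apply/andP; split; lra.
have IN1 : (-1 : R) \in `[-1, 1] by rewrite in_itv /=; apply/andP; split; lra.
exists ((1 / 2)%:C *: (gam 1 + gam (-1))), ((1 / 2)%:C *: (gam 1 - gam (-1))).
have g1 := gs _ I1; have gN1 := gs _ IN1; split.
- by apply: fixed_scale => //; exact: fixedD.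
- apply: fixed_scale => //; apply: fixedD => //.
  have -> : - gam (-1) = (-1)%:C *: gam (-1) by rewrite rmorphN1 scaleN1r.
  exact: fixed_scale.
move=> s; rewrite in_itv /= => /andP[sN1 s1].
(* [s] is the combination of [-1] and [1] in which [1] has weight [(1 + s) / 2]. *)
have lI : (1 + s) / 2 \in `[0, 1] by rewrite in_itv /=; apply/andP; split; lra.
have := ga _ _ _ IN1 I1 lI.
have -> : (1 - (1 + s) / 2) * -1 + (1 + s) / 2 * 1 = s by field.
move=> ->; rewrite scalerA !scalerDr !scalerN addrACA -scalerBl -scalerDl addrC.
by rewrite -rmorphM -rmorphD -rmorphB; congr (_%:C *: _ + _%:C *: _); field.
Qed.

Lemma psh_convex : plurisubharmonic f -> convex_fun (fixed_space sigma) fR.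
Proof.
move=> pf; split=> // gam /segment_line[a [v [sa sv gE]]].
rewrite !gE ?in_itv /=; try by apply/andP; split; lra.
have I0 : (0 : R) \in `[-1, 1] by rewrite in_itv /=; apply/andP; split; lra.
have := circle_mean_chord (line_continuous sa sv)
  (fun c r => psh_line c r sa sv pf) I0.
by rewrite mulr0 addr0 [in leRHS]addrC.
Qed.

(** On the disc [a + z v] the value at the centre is strictly below the mean of [h (cos t)]. That
    mean is at most the mean of the chord of [h] at [cos t], which is its value at [0]. *)
Lemma strictly_psh_strictly_convex : strictly_plurisubharmonic f ->
  strictly_convex_fun (fixed_space sigma) fR.
Proof.
move=> [pf spf]; split; first exact: psh_convex.
move=> gam /segment_line[a [v [sa sv gE]]] [s [t [sI tI gst]]].
have v0 : v != 0.
  by apply: contra_neq gst => v0; rewrite !gE// v0 !scaler0.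
rewrite !gE ?in_itv /=; try by apply/andP; split; lra.
have nc : nonconstant_disc (disc a v 0 1).
  exists 0, 1; rewrite !closed_unit_discE rnorm0 {1}/rnorm normr1 /=; split => //.
  rewrite /disc rmorph0 rmorph1 !mul1r !add0r scale0r scale1r addr0 eq_sym.
  by rewrite -subr_eq0 addrAC subrr add0r.
have := spf _ (disc_holomorphic a v 0 1) nc.
rewrite disc_mean// lte_fin /disc mulr0 addr0.
rewrite (projection_id sigma_antilinear piR_projection); last first.
  by apply: fixedD => //; exact: fixed_scale.
set h := fun s : R => fR (a + s%:C *: v).
have ch : continuous h by exact: line_continuous.
move/lt_le_trans; apply.
have ccos : continuous (fun t : R => 0 + 1 * cos t).
  move=> x; apply: cvgD; first exact: cvg_cst.
  by apply: cvgM; [exact: cvg_cst|exact: continuous_cos].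
have := circle_int_affine_cos ((h 1 + h (-1)) / 2) ((h 1 - h (-1)) / 2).
rewrite [in leRHS]addrC => <-; apply: le_circle_int.
- by move=> x; apply: (@continuous_comp _ _ _ (fun t => 0 + 1 * cos t) h);
    [exact: ccos|exact: ch].
- move=> x; apply: cvgD; first exact: cvg_cst.
  by apply: cvgM; [exact: cvg_cst|exact: continuous_cos].
move=> x; rewrite -[fR _]/(h (0 + 1 * cos x)) add0r mul1r.
apply: circle_mean_chord => //; first by move=> c r; exact: psh_line.
by rewrite in_itv /= cos_geN1 cos_le1.
Qed.

End PshConvex.

(** * Strictness *)

Section UnitCircle.
Variable R : realType.
Implicit Types (z w a : R[i]).

(** [acos] covers the upper half and [2 * pi - acos] the lower half. The angle is taken nonnegative
    for the rounding in [dyadic_dense]. *)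
Lemma expi_surjective z : rnorm (z : R[i]^o) = 1 ->
  exists2 t : R, 0 <= t & expi t = z.
Proof.
rewrite rnorm_complex; case: z => x y /= xy1.
have {}xy1 : x ^+ 2 + y ^+ 2 = 1.
  by rewrite -[LHS]sqr_sqrtr ?xy1 ?expr1n// addr_ge0 ?sqr_ge0.
have x1 : -1 <= x <= 1.
  rewrite -ler_norml -(@expr_le1 _ 2)// real_normK ?num_real// -xy1.
  by rewrite lerDl sqr_ge0.
have yE : 1 - x ^+ 2 = y ^+ 2 by rewrite -xy1 addrC addKr.
have [y0|y0] := leP 0 y.
  exists (acos x); first exact: acos_ge0.
  rewrite /expi acosK ?in_itv//= sin_acos// yE sqrtr_sqr ger0_norm//.
exists (2 * pi - acos x).
  by rewrite subr_ge0 (le_trans (acos_lepi x1))// ler_peMl ?pi_ge0// ler1n.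
rewrite /expi mulr_natl.
have -> : cos (pi *+ 2 - acos x) = x.
  by rewrite addrC cosD2pi cosN acosK// in_itv.
have -> : sin (pi *+ 2 - acos x) = y.
  by rewrite addrC sinD2pi sinN sin_acos// yE sqrtr_sqr ltr0_norm// opprK.
by [].
Qed.

(** [t] is rounded down to a grid of mesh [2 * pi / 2 ^+ k < d]. *)
Lemma dyadic_dense (t d : R) : 0 <= t -> 0 < d ->
  exists j k : nat, `|t - j%:R / 2 ^+ k * (2 * pi)| < d.
Proof.
move=> t0 d0.
have p0 : 0 < 2 * pi :> R by rewrite mulr_gt0 ?pi_gt0.
have [k kd] := halving_lt (2 * pi) d0.
have k0 : 0 < 2 ^+ k :> R by rewrite exprn_gt0.
pose s := t / (2 * pi) * 2 ^+ k.
have s0 : 0 <= s by rewrite mulr_ge0 ?divr_ge0 ?(ltW p0) ?(ltW k0).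
exists (Num.truncn s), k.
have /andP[js sj] := truncn_itv s0.
apply: le_lt_trans kd.
have -> : t - (Num.truncn s)%:R / 2 ^+ k * (2 * pi) =
    (2 * pi / 2 ^+ k) * (s - (Num.truncn s)%:R).
  have gen (p q n : R) : p != 0 -> q != 0 ->
      t - n / q * p = p / q * (t / p * q - n) by move=> *; field; apply/andP.
  by rewrite gen// gt_eqF.
rewrite normrM ger0_norm ?divr_ge0 ?(ltW p0) ?(ltW k0)// ler_piMr//.
  by rewrite divr_ge0 ?(ltW p0) ?(ltW k0).
rewrite ger0_norm ?subr_ge0// lerBlDr addrC natr1; exact: ltW.
Qed.

(** For [|a| < 1], the automorphism of the disc that moves the centre [0] to [a]. *)
Definition moebius a z : R[i] := (z + a) / (1 + a^*%C * z).

Lemma moebius_den_neq0 a z : rnorm (a : R[i]^o) < 1 ->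
  rnorm (z : R[i]^o) <= 1 -> 1 + a^*%C * z != 0.
Proof.
move=> a1 z1; rewrite addrC addr_eq0; apply/eqP => az.
have : rnorm (a^*%C * z : R[i]^o) = 1 by rewrite az rnormN /rnorm normr1.
rewrite rnormcM; have -> : rnorm (a^*%C : R[i]^o) = rnorm (a : R[i]^o).
  by rewrite /rnorm normcJ.
have := rnorm_ge0 (z : R[i]^o); have := rnorm_ge0 (a : R[i]^o).
move: (rnorm _) (rnorm _) a1 z1 => u v; nra.
Qed.

Lemma sqr_rnorm_complex z : rnorm (z : R[i]^o) ^+ 2 = Re z ^+ 2 + Im z ^+ 2.
Proof. by rewrite rnorm_complex sqr_sqrtr// addr_ge0 ?sqr_ge0. Qed.

(** The sign of the right-hand side shows that the disc is preserved, and its vanishing for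
    [|z| = 1] that the circle is. *)
Let moebius_sqr a z : rnorm (1 + a^*%C * z : R[i]^o) ^+ 2 -
    rnorm (z + a : R[i]^o) ^+ 2 =
  (1 - rnorm (a : R[i]^o) ^+ 2) * (1 - rnorm (z : R[i]^o) ^+ 2).
Proof. by rewrite !sqr_rnorm_complex; case: a z => u v [x y] /=; ring. Qed.

Let moebiusE a z : rnorm (a : R[i]^o) < 1 -> rnorm (z : R[i]^o) <= 1 ->
  rnorm (moebius a z : R[i]^o) * rnorm (1 + a^*%C * z : R[i]^o) =
  rnorm (z + a : R[i]^o).
Proof. by move=> a1 z1; rewrite -rnormcM divfK// moebius_den_neq0. Qed.

Lemma rnorm_moebius_le1 a z : rnorm (a : R[i]^o) < 1 ->
  rnorm (z : R[i]^o) <= 1 -> rnorm (moebius a z : R[i]^o) <= 1.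
Proof.
move=> a1 z1; have den0 : 0 < rnorm (1 + a^*%C * z : R[i]^o).
  by rewrite lt_def rnorm_eq0 moebius_den_neq0// rnorm_ge0.
rewrite -(ler_pM2r den0) moebiusE// mul1r -ler_sqr ?nnegrE ?rnorm_ge0//.
by rewrite -subr_ge0 moebius_sqr mulr_ge0// subr_ge0 expr_le1 ?rnorm_ge0// ltW.
Qed.

Lemma rnorm_moebius_eq1 a z : rnorm (a : R[i]^o) < 1 ->
  rnorm (z : R[i]^o) = 1 -> rnorm (moebius a z : R[i]^o) = 1.
Proof.
move=> a1 z1; have zle : rnorm (z : R[i]^o) <= 1 by rewrite z1.
have den0 : rnorm (1 + a^*%C * z : R[i]^o) != 0.
  by rewrite rnorm_eq0 moebius_den_neq0.
apply: (mulIf den0); rewrite moebiusE// mul1r.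
apply/eqP; rewrite -(@eqrXn2 _ 2) ?rnorm_ge0// eq_sym -subr_eq0 moebius_sqr.
by rewrite z1 expr1n subrr mulr0.
Qed.

Lemma derivable_moebius a z : rnorm (a : R[i]^o) < 1 -> rnorm (z : R[i]^o) <= 1 ->
  derivable (moebius a : R[i]^o -> R[i]^o) z 1.
Proof.
move=> a1 z1; apply: derivableM.
  by apply: derivableD; [exact: derivable_id|exact: derivable_cst].
apply: derivableV; first exact: moebius_den_neq0.
apply: derivableD; first exact: derivable_cst.
by apply: derivableM; [exact: derivable_cst|exact: derivable_id].
Qed.

End UnitCircle.

Lemma rnorm_le_eq (R : realType) (V : normedModType R[i]) (x y : V) :
  (forall e : R, 0 < e -> rnorm (x - y) <= e) -> x = y.
Proof.
move=> h; apply/eqP; rewrite -subr_eq0 -rnorm_eq0 eq_le rnorm_ge0 andbT.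
by apply/ler_addgt0Pl => e /h; rewrite addr0.
Qed.

(** * Composition of holomorphic maps, and constancy when the derivative vanishes *)

Section HolomorphicComp.
Variables (R : realType) (E : completeNormedModType R[i]).
Implicit Types (gam : R[i] -> E).

Lemma holomorphic_comp gam (phi : R[i] -> R[i]) :
  holomorphic_on (@closed_unit_disc R) gam ->
  (forall z : R[i], rnorm (z : R[i]^o) <= 1 -> rnorm (phi z : R[i]^o) <= 1) ->
  (forall z : R[i], rnorm (z : R[i]^o) <= 1 ->
     derivable (phi : R[i]^o -> R[i]^o) z 1) ->
  holomorphic_on (@closed_unit_disc R) (gam \o phi).
Proof.
move=> hg phi1 dphi z; rewrite closed_unit_discE => z1.
apply/derivable1_diffP.
apply: (@differentiable_comp _ (R[i]^o) (R[i]^o) _ phi gam).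
  exact/derivable1_diffP/dphi.
by apply/derivable1_diffP/hg; rewrite closed_unit_discE phi1.
Qed.

Lemma is_derive_lipschitz0 (g : R -> R) (t : R) :
  (forall e, 0 < e -> exists2 d, 0 < d & forall s, `|s - t| < d ->
     `|g s - g t| <= e * `|s - t|) -> is_derive t 1 g 0.
Proof.
move=> gt.
suff hc : h^-1 *: ((g \o shift t) (h *: 1) - g t) @[h --> 0^'] --> (0 : R).
  by split; [apply/cvg_ex; exists 0|exact: cvg_lim hc].
apply/cvgrPdist_le => e e0; rewrite -nbhs_nearE; apply/nbhs_normP.
have [d d0 dP] := gt e e0; exists d => // h /=; rewrite sub0r normrN => hd h0.
rewrite sub0r normrN /shift /= [h *: 1]mulr1 [_ *: _]mulrC.
rewrite normrM normfV ler_pdivrMr ?normr_gt0//.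
by have := dP (h + t); rewrite addrK; apply.
Qed.

(* The mean value theorem for the real function |gam(tz) - gam(0)|. *)
Lemma holomorphic_derive0_cst gam :
  holomorphic_on (@closed_unit_disc R) gam ->
  (forall z : R[i], rnorm (z : R[i]^o) < 1 -> forall e : R, 0 < e ->
     exists2 d : R, 0 < d & forall w : R[i], rnorm (w - z : R[i]^o) < d ->
     rnorm (gam w - gam z) <= e * rnorm (w - z : R[i]^o)) ->
  forall z : R[i], rnorm (z : R[i]^o) <= 1 -> gam z = gam 0.
Proof.
move=> hg g0 z z1.
pose g (t : R) := rnorm (gam (t%:C * z) - gam 0).
have scale1 (t : R) : 0 <= t -> t <= 1 -> rnorm (t%:C * z : R[i]^o) <= t.
  by move=> t0 t1; rewrite (rnormZr t (z : R[i]^o)) ger0_norm// ler_piMr.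
have rdist (s t : R) : rnorm (s%:C * z - t%:C * z : R[i]^o) <= `|s - t|.
  by rewrite -mulrBl -rmorphB (rnormZr _ (z : R[i]^o)) ler_piMr.
have gdist s t : `|g s - g t| <= rnorm (gam (s%:C * z) - gam (t%:C * z)).
  by rewrite (le_trans (ler_dist_rnorm _ _))// opprB addrA subrK.
have dg (t : R) : t \in `]0, 1[ -> is_derive t 1 g 0.
  rewrite in_itv /= => /andP[t0 t1]; apply: is_derive_lipschitz0 => e e0.
  have tz : rnorm (t%:C * z : R[i]^o) < 1.
    by rewrite (le_lt_trans _ t1)// scale1 ?ltW.
  have [d d0 dP] := g0 _ tz e e0; exists d => // s sd.
  rewrite (le_trans (gdist _ _))// (le_trans (dP _ _))//.
    exact: le_lt_trans sd.
  by rewrite ler_wpM2l// ltW.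
(* The derivative is controlled only in the open disc; if [|z| = 1], the end [t = 1] is reached by
   continuity. *)
have cg : {within `[0, 1], continuous g}.
  apply: continuous_in_subspaceT => t; rewrite inE /= in_itv /= => /andP[t0 t1].
  apply/cvgrPdist_le => e e0.
  have tz : closed_unit_disc (t%:C * z).
    by rewrite closed_unit_discE (le_trans _ t1)// scale1.
  have : {for (t%:C * z : R[i]^o), continuous (gam : R[i]^o -> E)}.
    exact/differentiable_continuous/derivable1_diffP/hg.
  move=> /cvg_rnormP/(_ e e0); rewrite -nbhs_nearE => /nbhs_rnormP[d d0 dP].
  rewrite -nbhs_nearE; apply/nbhs_normP; exists d => // s /= ts.
  rewrite distrC (le_trans (gdist _ _))// dP//.
  by rewrite (le_lt_trans (rdist _ _))// distrC.
have [c _] := MVT ltr01 dg cg.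
rewrite mul0r /g rmorph0 rmorph1 mul0r mul1r subrr rnorm0 subr0 => /eqP.
by rewrite rnorm_eq0 subr_eq0 => /eqP.
Qed.

End HolomorphicComp.

(** * Strictly convex implies strictly plurisubharmonic *)

Section StrictConvexity.
Variables (R : realType) (E : completeNormedModType R[i]) (sigma piR : E -> E).
Hypotheses (sigma_antilinear : antilinear sigma)
  (sigma_continuous : continuous sigma)
  (piR_projection : projection_along (fixed_space sigma)
                      (times_i (fixed_space sigma)) piR).
Implicit Types (gam : R[i] -> E) (c x y : E).

Let piRB x y : piR (x - y) = piR x - piR y.
Proof.
rewrite (projectionD sigma_antilinear piR_projection).
have -> : - y = (-1)%:C *: y by rewrite rmorphN1 scaleN1r.
by rewrite (projectionZr sigma_antilinear piR_projection) rmorphN1 scaleN1r.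
Qed.

Let piR_cvg := @projection_continuous _ _ _ _ sigma_antilinear
  sigma_continuous piR_projection.

(** The kernel of [piR] is closed, so it contains limits of difference quotients that lie in it. *)
Let piR0_closed y :
  (forall e : R, 0 < e -> exists2 x, piR x = 0 & rnorm (x - y) <= e) ->
  piR y = 0.
Proof.
move=> h; apply: rnorm_le_eq => e e0; rewrite subr0.
have /cvg_rnormP/(_ e e0) := @piR_cvg y.
rewrite -nbhs_nearE => /nbhs_rnormP[d d0 dP].
have [x x0 xy] := h _ (divr_gt0 d0 (ltr0Sn R 1)).
have := dP x; rewrite x0 sub0r rnormN; apply.
by rewrite (le_lt_trans xy)// ltr_pdivrMr// ltr_pMr// ltr1n.
Qed.

(* The derivative D of gam satisfies piR D = 0 and piR (i D) = 0. *)
Let derive0_of_real_part_cst gam c : holomorphic_on (@closed_unit_disc R) gam ->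
  (forall z : R[i], rnorm (z : R[i]^o) <= 1 -> piR (gam z) = c) ->
  forall z : R[i], rnorm (z : R[i]^o) < 1 -> forall e : R, 0 < e ->
     exists2 d : R, 0 < d & forall w : R[i], rnorm (w - z : R[i]^o) < d ->
     rnorm (gam w - gam z) <= e * rnorm (w - z : R[i]^o).
Proof.
move=> hg gc z z1.
have z1' : closed_unit_disc z by rewrite closed_unit_discE ltW.
have [A AP] := derivable_rnormP (hg z z1').
suff A0 : A = 0.
  by move=> e /AP[d d0 dP]; exists d => // w /dP; rewrite A0 scaler0 subr0.
(* [u *: A] is the limit of the quotients of [gam] along real multiples of [u], and [piR] kills
   these because [piR \o gam] is constant. *)
have piA (u : R[i]) : rnorm (u : R[i]^o) = 1 -> piR (u *: A) = 0.
  move=> u1; apply: piR0_closed => e e0; have [d d0 dP] := AP e e0.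
  have r10 : 0 < (1 - rnorm (z : R[i]^o)) by rewrite subr_gt0.
  (* The step is within reach of the approximation and keeps [z + r u] in the closed disc. *)
  pose r := Num.min (d / 2) (1 - rnorm (z : R[i]^o)).
  have r0 : 0 < r by rewrite lt_min r10 divr_gt0.
  have rd : r <= d / 2 by rewrite ge_min lexx.
  have rz : r <= 1 - rnorm (z : R[i]^o) by rewrite ge_min lexx orbT.
  have ru : rnorm (r%:C * u : R[i]^o) = r.
    by rewrite (rnormZr r (u : R[i]^o)) u1 mulr1 ger0_norm// ltW.
  have zr : rnorm (z + r%:C * u : R[i]^o) <= 1.
    by rewrite (le_trans (ler_rnormD (z : R[i]^o) _))// ru; lra.
  exists (r^-1%:C *: (gam (z + r%:C * u) - gam z)).
    rewrite (projectionZr sigma_antilinear piR_projection) piRB.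
    by rewrite !gc ?(ltW z1)// subrr scaler0.
  have := dP (z + r%:C * u); rewrite addrAC subrr add0r ru => H.
  have -> : r^-1%:C *: (gam (z + r%:C * u) - gam z) - u *: A =
      r^-1%:C *: (gam (z + r%:C * u) - gam z - (r%:C * u) *: A).
    rewrite [RHS]scalerBr; congr (_ - _).
    by rewrite scalerA mulrA -rmorphM mulVf ?gt_eqF// mul1r.
  rewrite rnormZr ger0_norm ?invr_ge0 ?(ltW r0)// ler_pdivrMl// [r * e]mulrC.
  by apply: H; lra.
have r1 : rnorm (1 : R[i]^o) = 1 by rewrite /rnorm normr1.
have ri : rnorm ('i%C : R[i]^o) = 1.
  by rewrite rnorm_complex /= expr0n expr1n add0r sqrtr1.
(* The directions [1] and ['i] give [A + sigma A = 0] and [A - sigma A = 0]. *)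
have := piA 1 r1; have := piA 'i%C ri.
rewrite !(projectionE sigma_antilinear piR_projection) scale1r.
rewrite sigma_antilinear.2.
have -> : ('i%C : R[i])^*%C = - 'i%C.
  by apply/eqP; rewrite eq_complex /= oppr0 !eqxx.
have half0 x : 2^-1 *: x = 0 :> E -> x = 0.
  by move/eqP; rewrite scaler_eq0 invr_eq0 pnatr_eq0 /= => /eqP.
move=> /half0; rewrite scaleNr -scalerBr => /eqP; rewrite scaler_eq0.
have -> /= : ('i%C == 0 :> R[i]) = false by rewrite eq_complex /= oner_eq0 andbF.
rewrite subr_eq0 => /eqP AA /half0; rewrite -AA -mulr2n -scaler_nat => /eqP.
by rewrite scaler_eq0 pnatr_eq0 /= => /eqP.
Qed.

Lemma circle_real_part_cst gam c : holomorphic_on (@closed_unit_disc R) gam ->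
  (forall z : R[i], rnorm (z : R[i]^o) = 1 -> piR (gam z) = c) ->
  forall z : R[i], rnorm (z : R[i]^o) <= 1 -> gam z = gam 0.
Proof.
move=> hg gc; apply: holomorphic_derive0_cst => //.
apply: (@derive0_of_real_part_cst _ c) => // a.
rewrite le_eqVlt => /predU1P[/gc//|a1].
(* [gam \o moebius a] has centre value [gam a], and its real part is [c] on the circle; all its
   circle sums thus project to [c], and so does [gam a]. *)
have hga := holomorphic_comp hg (fun z => rnorm_moebius_le1 a1)
  (fun z => derivable_moebius a1).
have := cvg_comp _ _ (circle_sum_holomorphic hga) (@piR_cvg _).
rewrite /= {2}/moebius add0r mulr0 addr0 divr1 => h.
apply: rnorm_le_eq => e e0; have /cvg_rnormP/(_ e e0)[m _ /(_ m (leqnn _))] := h.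
rewrite /= (projection_circle_sum sigma_antilinear piR_projection).
have -> : circle_sum (piR \o (fun t => gam (moebius a (expi t)))) m = c.
  rewrite -[RHS](circle_sum_cst R _ m); congr circle_sum.
  by apply/funext => t /=; rewrite gc// rnorm_moebius_eq1// rnorm_expi.
by rewrite rdistC.
Qed.

Variable fR : E -> R.
Hypothesis fR_continuous : {within fixed_space sigma, continuous fR}.

(** Dyadic angles are dense and the real part is continuous along the circle. *)
Let real_part_cst_of_dyadic gam : holomorphic_on (@closed_unit_disc R) gam ->
  (forall j k : nat,
    piR (gam (expi (j%:R / 2 ^+ k * (2 * pi)))) = piR (gam (expi 0))) ->
  forall z : R[i], rnorm (z : R[i]^o) = 1 -> piR (gam z) = piR (gam (expi 0)).
Proof.
move=> hg gd z /expi_surjective[t t0 <-]; apply: rnorm_le_eq => e e0.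
have cu : {for t, continuous (fun t => piR (gam (expi t)))}.
  apply: (@continuous_comp _ _ _ (fun t => gam (expi t)) piR);
    last exact: piR_cvg.
  exact: continuous_expi_comp.
have /cvg_rnormP/(_ e e0) := cu.
rewrite -nbhs_nearE => /nbhs_normP[d d0 dP].
have [j [k jk]] := dyadic_dense t0 d0.
by have := dP _ jk; rewrite /= gd rdistC.
Qed.

Lemma strictly_convex_strictly_psh :
  strictly_convex_fun (fixed_space sigma) fR ->
  strictly_plurisubharmonic (fun x => (fR (piR x))%:E).
Proof.
move=> scvx; have cvx := convex_midpoint sigma_antilinear scvx.1.
have scvx2 := strictly_convex_midpoint sigma_antilinear scvx.
split; first exact: (midpoint_convex_psh sigma_antilinear sigma_continuous).
move=> gam /holomorphic_disc_closed[del hd gd] [z [w [z1 w1 gzw]]].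
have g1 t : gam (expi t) = del (expi t).
  by apply: gd; rewrite closed_unit_discE rnorm_expi.
have gE : (fun t => fR (piR (gam (expi t)))) =
    (fun t => fR (piR (del (expi t)))).
  by apply/funext => t; rewrite g1.
have cF : continuous (fun t => fR (piR (del (expi t)))).
  exact: (continuous_circle sigma_antilinear sigma_continuous piR_projection
    fR_continuous).
rewrite (@circle_mean_int _ _ (fR \o piR)) /= gE//.
rewrite lte_fin gd ?closed_unit_discE ?rnorm0//.
(* Otherwise the real part would be constant on the circle, which forces [del] to be constant on the
   disc. *)
have [j [k jk]] : exists j k : nat,
    piR (del (expi (j%:R / 2 ^+ k * (2 * pi)))) <> piR (del (expi 0)).
  apply: contrapT => nd.
  have dcst : forall x : R[i], rnorm (x : R[i]^o) <= 1 -> del x = del 0.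
    apply: (circle_real_part_cst hd (real_part_cst_of_dyadic hd _)) => j k.
    by apply: contrapT => jk; apply: nd; exists j, k.
  move: (z1) (w1); rewrite !closed_unit_discE => /dcst dz /dcst dw.
  by move: gzw; rewrite (gd z)// (gd w)// dz dw eqxx.
set s := j%:R / _ * _ in jk.
(* The average of [del] with its rotation by [s] has the same value at [0]. *)
pose del2 z := 2^-1 *: (del z + del (expi s * z)).
have hd2 : holomorphic_on (@closed_unit_disc R) del2.
  move=> a a1; apply: derivableZ; apply: derivableD; first exact: hd.
  apply: (@holomorphic_comp R E del (fun z => expi s * z)) => //.
  by move=> x x1; rewrite rnormcM rnorm_expi mul1r.
have del2E t : piR (del2 (expi t)) =
    2^-1 *: (piR (del (expi t)) + piR (del (expi (t + s)))).
  have h2 : 2^-1 = (2^-1)%:C :> R[i] by rewrite fmorphV rmorph_nat.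
  rewrite /del2 h2 (projectionZr sigma_antilinear piR_projection).
  by rewrite (projectionD sigma_antilinear piR_projection) (addrC t) expiD.
have d0 : del2 0 = del 0.
  by rewrite /del2 mulr0 -mulr2n -[del 0 *+ 2]scaler_nat scalerA mulVf ?scale1r.
have fixP x : sigma (piR x) = piR x := projection_fixed piR_projection x.
(* [G] has the same circle mean as [fR \o piR] along [del], since [s] is dyadic. By convexity it
   dominates [fR \o piR] along [del2], strictly at [t = 0] by the choice of [s]. *)
pose G t := (fR (piR (del (expi t))) + fR (piR (del (expi (t + s))))) / 2.
have cG : continuous G.
  move=> t; apply: cvgM; last exact: cvg_cst.
  apply: cvgD; first exact: cF.
  apply: (@continuous_comp _ _ _ (fun t => t + s)
    (fun t => fR (piR (del (expi t))))).
    by apply: cvgD; [exact: cvg_id|exact: cvg_cst].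
  exact: cF.
have per t : fR (piR (del (expi (t + 2 * pi)))) = fR (piR (del (expi t))).
  by rewrite /expi mulr_natl cosD2pi sinD2pi.
rewrite -(circle_int_half_shift j k cF per) -/s -[X in _ < X]/(circle_int G) -d0.
apply: le_lt_trans (midpoint_convex_disc sigma_antilinear sigma_continuous
  piR_projection fR_continuous cvx hd2) _.
apply: (@lt_circle_int _ _ _ 0) => //.
- exact: (continuous_circle sigma_antilinear sigma_continuous piR_projection
    fR_continuous).
- by move=> t; rewrite del2E; exact: cvx.
- by rewrite in_itv /= lexx mulr_ge0 ?pi_ge0.
- rewrite del2E /G add0r; apply: scvx2 => //.
  by rewrite eq_sym; apply/eqP.
Qed.

End StrictConvexity.

Theorem theorem14 (R : realType) (E : completeNormedModType R[i])
    (sigma : E -> E)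
    (sigma_antilinear : antilinear sigma)
    (sigma_involutive : involutive sigma)
    (sigma_continuous : continuous sigma)
    (piR : E -> E)
    (piR_projection : projection_along (fixed_space sigma)
                        (times_i (fixed_space sigma)) piR)
    (fR : E -> R)
    (fR_continuous : {within fixed_space sigma, continuous fR}) :
  let f : E -> \bar R := fun z => (fR (piR z))%:E in
  (convex_fun (fixed_space sigma) fR <-> plurisubharmonic f) /\
  (strictly_convex_fun (fixed_space sigma) fR <-> strictly_plurisubharmonic f).
Proof.
move=> f; split; split.
- move=> /(convex_midpoint sigma_antilinear).
  exact: midpoint_convex_psh.
- exact: psh_convex.
- exact: strictly_convex_strictly_psh.
- exact: strictly_psh_strictly_convex.
Qed.
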